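(* Let $\{S_i\}_{i=1}^\infty$ be a convergent sequence of non-negative symmetric (square) matrices. Then there exists a symmetric Borel measure $\mu$ (of finite total mass) on $\mathcal{C}\times\mathcal{C}$ such that for every natural number $k$, the limit of the sets $C(S_i,k)$ in the Hausdorff metric as $i\to\infty$ is $C(\mu,k)$.
   Context: Natural numbers $k$ are positive. $\mathcal{C}=\{0,1\}^{\mathbb{N}}$ is the Cantor set with the product topology and $\nu$ is the product of the uniform measures on $\{0,1\}$. A Borel measure on $\mathcal{C}\times\mathcal{C}$ is symmetric if it is invariant under $(x,y)\mapsto(y,x)$. For a matrix $S$, $\gamma(S)$ denotes the sum of its entries. $\mathcal{K}(k,n)$ is the set of all non-negative real $k\times n$ matrices with every row sum equal to $n/k$ and every column sum equal to $1$. For an $n\times n$ matrix $S$, the $k$-shape is $C(S,k)=\{MSM^T : M\in\mathcal{K}(k,n)\}\subset\mathbb{R}^{k\times k}$, a compact set. A sequence $\{S_i\}$ of non-negative square matrices (sizes may vary with $i$) is convergent if there is a constant $c>0$ with $\gamma(S_i)<c$ for all $i$ and, for every natural number $k$, the sets $C(S_i,k)$ converge to some closed set in $[0,c]^{k\times k}$ with respect to the Hausdorff metric (induced by the entrywise $\ell_1$ norm on $\mathbb{R}^{k\times k}$). For a Borel measure $\mu$ on $\mathcal{C}\times\mathcal{C}$ of finite total measure, $C_0(\mu,k)$ is the set of all $k\times k$ matrices $M$ with $M(i,j)=\int_{\mathcal{C}\times\mathcal{C}} f_i(x)f_j(y)\,d\mu(x,y)$, where $f_1,\dots,f_k$ range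 over all families of non-negative Borel measurable functions on $\mathcal{C}$ with $\sum_{i=1}^k f_i=1$ everywhere and $\int_{\mathcal{C}} f_i\,d\nu=1/k$ for each $i$. $C(\mu,k)$ is the topological closure of $C_0(\mu,k)$ in $\mathbb{R}^{k\times k}$. *)

(* Defs.v *)
From HB Require Import structures.
From mathcomp Require Import all_boot all_order all_algebra.
From mathcomp Require Import all_classical all_reals all_analysis.
From mathcomp Require Import measurable_realfun lra zify.
Set Implicit Arguments.
Unset Strict Implicit.
Unset Printing Implicit Defensive.
Import Order.TTheory GRing.Theory Num.Theory.
Import numFieldNormedType.Exports.
Local Open Scope classical_set_scope.
Local Open Scope ring_scope.

Notation borel T := (g_sigma_algebraType (@open T)).

Definition rectangle (n : nat) (A : nat -> {set bool}) : set cantor_space :=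
  [set x | forall i, (i < n)%N -> x i \in A i].

(* The product measure of the uniform measures A |-> #|A| / 2 on bool: its value
   on rectangles over finitely many coordinates, which determines it. *)
Definition is_fair_coin_product (R : realType)
    (P : probability (borel cantor_space) R) :=
  forall (n : nat) (A : nat -> {set bool}),
    P (rectangle n A) = (\prod_(i < n) (#|A i|%:R / 2))%:E.

Section fair_coin_existence.
Variable R : realType.

Let prefix_set (s : seq bool) : set cantor_space :=
  [set y | forall i, (i < size s)%N -> y i = nth false s i].

Let open_prefix (x : cantor_space) (U : set cantor_space) : open U -> U x ->
  exists n, prefix_set (mkseq x n) `<=` U.
Proof.
move=> oU Ux; apply: contrapT => /forallNP nU.
have /choice[y yP] : forall n, exists y, prefix_set (mkseq x n) y /\ ~ U y.
  by move=> n; have /existsNP[y /not_implyP] := nU n; exists y.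
have /(_ U) : (y : nat -> cantor_space) @ \oo --> x.
  apply/cvg_sup => i; apply/cvg_image.
    by apply/seteqP; split => // b _; exists (fun=> b).
  move=> V Vx; exists [set z | V (z i)] => //.
    exists i.+1 => // n /= ltin.
    rewrite (proj1 (yP n)) ?size_mkseq// nth_mkseq//; exact: nbhs_singleton.
  by apply/seteqP; split => [b [z zV <-]//|b Vb]; exists (fun=> b).
move=> /(_ (open_nbhs_nbhs (conj oU Ux)))[N _ /(_ N (leqnn N))].
exact: (proj2 (yP N)).
Qed.

(* Binary digits: the product measure is the image of Lebesgue measure on [0, 1[
   under dig. *)
Let dig (x : R) : cantor_space := fun n => odd (Num.truncn (x * 2 ^+ n.+1)).

Let measurable_truncn_lt (c : R) (m : nat) :
  measurable [set x : R | (Num.truncn (x * c) < m)%N].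
Proof.
case: m => [|m]; first by rewrite (_ : mkset _ = set0)//; apply/seteqP; split.
rewrite (_ : mkset _ = (fun x => x * c) @^-1` `]-oo, m.+1%:R[).
  rewrite -[X in measurable X]setTI.
  by apply: measurable_funM => //; exact: measurable_itv.
by apply/seteqP; split => x /=; rewrite in_itv/= ltnS truncn_le_nat.
Qed.

Let measurable_dig1 (n : nat) (b : bool) : measurable [set x : R | dig x n = b].
Proof.
rewrite (_ : mkset _ = \bigcup_(m in [set m | odd m = b])
   ([set x : R | (Num.truncn (x * 2 ^+ n.+1) < m.+1)%N] `\`
    [set x : R | (Num.truncn (x * 2 ^+ n.+1) < m)%N])).
  by apply: bigcup_measurable => m _; exact: measurableD.
apply/seteqP; split => x /=.
  by move=> <-; exists (Num.truncn (x * 2 ^+ n.+1)) => //=; rewrite ltnS leqnn ltnn.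
by move=> [m <-] [/=]; rewrite ltnS leq_eqVlt => /orP[/eqP <-//|->].
Qed.

Let measurable_dig : measurable_fun setT (dig : R -> borel cantor_space).
Proof.
apply: (@measurability _ _ _ (borel cantor_space) setT dig (@open cantor_space)) => //.
move=> _ [U oU <-]; rewrite setTI.
rewrite (_ : dig @^-1` U = \bigcup_s
   (if `[< prefix_set s `<=` U >] then dig @^-1` prefix_set s else set0)).
  apply: countable_bigcupT_measurable => [|s]; first exact: countableP.
  case: ifP => // _.
  rewrite (_ : _ @^-1` _ =
      \bigcap_(i in [set i | (i < size s)%N]) [set x | dig x i = nth false s i]).
    by apply: bigcap_measurableType => i _; exact: measurable_dig1.
  by apply/seteqP; split.
apply/seteqP; split => x /=.
  move=> Ux; have [n nU] := open_prefix oU Ux.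
  exists (mkseq (dig x) n) => //; rewrite asboolT//= => i.
  by rewrite size_mkseq => ?; rewrite nth_mkseq.
by move=> [s _]; case: asboolP => // sU; exact: sU.
Qed.

Let I01 : set R := `[0, 1[.
Let mI01 : measurable I01. Proof. exact: measurable_itv. Qed.

Let Q : set (measurableTypeR R) -> \bar R := mrestr lebesgue_measure mI01.
HB.instance Definition _ := Measure.on Q.

Let Q_setT : Q [set: _] = 1%E.
Proof.
by rewrite /Q /mrestr setTI lebesgue_measure_itv/= lte_fin ltr01 oppr0 adde0.
Qed.
HB.instance Definition _ := Measure_isProbability.Build _ _ _ Q Q_setT.

Let digB : measurableTypeR R -> borel cantor_space := dig.
HB.instance Definition _ := isMeasurableFun.Build _ _ _ _ digB measurable_dig.

Let P : probability (borel cantor_space) R := distribution Q digB.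

Let truncn_half (y : R) : 0 <= y -> (Num.truncn (y * 2))./2 = Num.truncn y.
Proof.
move=> y0; apply/esym/truncn_def; set t := Num.truncn (y * 2).
have /andP[t1 t2] : t%:R <= y * 2 < t.+1%:R by apply: truncn_itv; lra.
have tE : (t%:R : R) = (odd t)%:R + 2 * t./2%:R.
  by rewrite -[in LHS](odd_double_half t) natrD -muln2 natrM mulrC.
move: t1 t2; rewrite -!natr1 tE; case: (odd t) => /= t1 t2; apply/andP; split; lra.
Qed.

Let code (w : nat -> bool) := fix code n :=
  if n is m.+1 then (w m + (code m).*2)%N else 0%N.

Let code_lt w n : (code w n < 2 ^ n)%N.
Proof. by elim: n => // n; rewrite expnS /=; case: (w n) => /=; lia. Qed.

Let digP (w : nat -> bool) (x : R) n : 0 <= x < 1 ->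
  (forall i, (i < n)%N -> dig x i = w i) <-> Num.truncn (x * 2 ^+ n) = code w n.
Proof.
move=> /andP[x0 x1].
have half m : (Num.truncn (x * 2 ^+ m.+1))./2 = Num.truncn (x * 2 ^+ m).
  by rewrite exprSr mulrA truncn_half// mulr_ge0// exprn_ge0.
elim: n => [|n IH]; first by split=> // _; apply: truncn_def; rewrite /= mulr1; lra.
split=> [xw|xc] /=.
  rewrite -[LHS]odd_double_half half (proj1 IH)// => [|i lin].
    by rewrite -(xw n (leqnn _)).
  by apply: xw; exact: leqW.
move=> i; rewrite ltnS leq_eqVlt => /orP[/eqP ->|].
  by rewrite /dig xc /= oddD odd_double addbF; case: (w n).
apply: (proj2 IH); rewrite -half xc /=.
by case: (w n); rewrite ?add0n ?add1n /= ?uphalf_double ?doubleK.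
Qed.

Let P_prefix (w : nat -> bool) n :
  P [set x : cantor_space | forall i, (i < n)%N -> x i = w i] = (2 ^- n)%:E.
Proof.
have c0 : (0 : R) < 2 ^+ n by rewrite exprn_gt0.
rewrite /P /distribution /pushforward /= /Q /mrestr.
rewrite (_ : _ `&` _ =
    [set` `[(code w n)%:R / 2 ^+ n : R, (code w n).+1%:R / 2 ^+ n[]).
  rewrite lebesgue_measure_itv/= lte_fin ltr_pM2r ?invr_gt0// ltr_nat ltnSn.
  by rewrite -EFinD -mulrBl -natrB// subSnn mul1r.
apply/seteqP; split => x /=; rewrite !in_itv/=.
  move=> [xw x01]; have /digP := xw => /(_ x01) xc.
  rewrite ler_pdivrMr// ltr_pdivlMr// -xc truncn_itv//.
  by case/andP: x01 => ? ?; rewrite mulr_ge0// ltW.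
rewrite ler_pdivrMr// ltr_pdivlMr// => xc.
have x01 : 0 <= x < 1.
  case/andP: xc => xc1 xc2; apply/andP; split.
    by rewrite -(pmulr_lge0 _ c0); exact: le_trans xc1.
  rewrite -(ltr_pM2r c0) mul1r; apply: lt_le_trans xc2 _.
  by rewrite -natrX ler_nat code_lt.
by split=> //; apply/digP => //; exact: truncn_def.
Qed.

Let measurable_rectangle n A : measurable (rectangle n A : set (borel cantor_space)).
Proof.
rewrite (_ : rectangle n A = \bigcap_(i in [set i | (i < n)%N])
    [set x : cantor_space | x i \in A i]); last by apply/seteqP; split.
apply: bigcap_measurableType => i _; apply: sub_sigma_algebra.
have /continuousP pc : continuous (fun x : cantor_space => x i).
  exact: (@proj_continuous nat (fun=> bool) i).
by apply: (pc [set b | b \in A i]); exact: discrete_open.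
Qed.

Let P_rectangle k n (A : nat -> {set bool}) :
    (forall i, (k <= i)%N -> exists b, A i = [set b]%SET) ->
  P (rectangle n A) = (\prod_(i < n) (#|A i|%:R / 2))%:E.
Proof.
elim: k A => [A A1|k IH A A1].
  have /choice[w wP] : forall i, exists b, A i = [set b]%SET by move=> i; exact: A1.
  rewrite (_ : rectangle n A =
      [set x : cantor_space | forall i, (i < n)%N -> x i = w i]).
    rewrite P_prefix; congr EFin.
    under eq_bigr do rewrite wP cards1 div1r.
    by rewrite prodr_const card_ord exprVn.
  apply/seteqP; split => x /= xA i lin; have := xA i lin; rewrite wP inE.
    by move/eqP.
  by move=> ->.
have [kn|nk] := ltnP k n; last first.
  pose A' i := if (i < n)%N then A i else [set true]%SET.
  have -> : rectangle n A = rectangle n A'.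
    by apply/seteqP; split => x xA i lin; have := xA i lin; rewrite /A' lin.
  rewrite IH => [|i ki]; last by rewrite /A' ltnNge (leq_trans nk ki)/=; exists true.
  by congr EFin; apply: eq_bigr => i _; rewrite /A' ltn_ord.
pose A' b i := if i == k then [set b]%SET else A i.
have PA' b : P (rectangle n (A' b)) = (\prod_(i < n) (#|A' b i|%:R / 2))%:E.
  apply: IH => i ki; rewrite /A'; case: eqVneq => [_|ik]; first by exists b.
  by apply: A1; rewrite ltn_neqAle eq_sym ik.
pose r : R := \prod_(i < n | i != Ordinal kn) (#|A i|%:R / 2).
have rA : \prod_(i < n) (#|A i|%:R / 2) = #|A k|%:R / 2 * r.
  by rewrite (bigD1 (Ordinal kn)).
have rA' b : \prod_(i < n) (#|A' b i|%:R / 2) = 2^-1 * r.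
  rewrite (bigD1 (Ordinal kn))//= /A' eqxx cards1 div1r; congr (_ * _).
  by apply: eq_bigr => i /negbTE ik; rewrite -[X in if X then _ else _]/(i == Ordinal kn) ik.
pose B b := if b \in A k then rectangle n (A' b) else set0.
have mB b : measurable (B b : set (borel cantor_space)).
  by rewrite /B; case: ifP => // _; exact: measurable_rectangle.
have AB : rectangle n A = B true `|` B false.
  apply/seteqP; split => x.
    move=> xA; suff : B (x k) x by case: (x k); [left|right].
    rewrite /B xA// => i lin; rewrite /A'; case: eqVneq => [->|_]; rewrite ?inE//.
    exact: xA.
  have BA b : B b `<=` rectangle n A.
    rewrite /B; case: ifP => [bA y yA i lin|_ y []]; have := yA i lin; rewrite /A'.
    by case: eqVneq => // ->; rewrite inE => /eqP ->.
  by case; exact: BA.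
have PB b : P (B b) = ((b \in A k)%:R / 2 * r)%:E.
  rewrite /B; case: ifP => _; first by rewrite PA' rA' div1r.
  by rewrite measure0 !mul0r.
rewrite AB measureU//; last first.
  apply/seteqP; split => // x []; rewrite /B.
  case: ifP => [_|_ []]; case: ifP => [_|_ _ []].
  by move=> /(_ _ kn) + /(_ _ kn); rewrite /A' eqxx !inE => /eqP ->.
rewrite [X in (X + _)%E]PB [X in (_ + X)%E]PB rA -EFinD -mulrDl -mulrDl -natrD.
congr ((_%:R / 2 * r)%:E).
by rewrite -sum1_card big_mkcond/= big_bool/=; do 2 case: (_ \in _).
Qed.

Lemma fair_coin_exists :
  exists P0 : probability (borel cantor_space) R, is_fair_coin_product P0.
Proof.
exists P => n A; pose A' i := if (i < n)%N then A i else [set true]%SET.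
have -> : rectangle n A = rectangle n A'.
  by apply/seteqP; split => x xA i lin; have := xA i lin; rewrite /A' lin.
rewrite (P_rectangle (k := n)) => [|i ki].
  by congr EFin; apply: eq_bigr => i _; rewrite /A' ltn_ord.
by rewrite /A' ltnNge ki; exists true.
Qed.

End fair_coin_existence.

Definition fair_coin (R : realType) : probability (borel cantor_space) R :=
  projT1 (cid (fair_coin_exists R)).

Lemma fair_coinP (R : realType) : is_fair_coin_product (fair_coin R).
Proof. exact: projT2 (cid (fair_coin_exists R)). Qed.

Unset Implicit Arguments.

Section matrix_shapes.
Context {R : realType}.

Definition entry_sum {n} (S : 'M[R]_n) : R := \sum_i \sum_j S i j.

Definition stochastic_partition (k n : nat) : set 'M[R]_(k, n) :=
  [set M | [/\ forall i j, 0 <= M i j,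
               forall i, \sum_j M i j = n%:R / k%:R &
               forall j, \sum_i M i j = 1]].

Definition matrix_shape {n} (S : 'M[R]_n) (k : nat) : set 'M[R]_k :=
  [set M *m S *m M^T | M in stochastic_partition k n].

Definition l1_dist {k} (A B : 'M[R]_k) : R := \sum_i \sum_j `|A i j - B i j|.

(* Extended-real valued, so that no boundedness or nonemptiness proviso is
   needed: the distance between an empty and a nonempty set is +oo. *)
Definition hausdorff_dist {k} (X Y : set 'M[R]_k) : \bar R :=
  maxe (ereal_sup [set ereal_inf [set (l1_dist A B)%:E | B in Y] | A in X])
       (ereal_sup [set ereal_inf [set (l1_dist A B)%:E | A in X] | B in Y]).

Definition hausdorff_cvg {k} (X : nat -> set 'M[R]_k) (Y : set 'M[R]_k) :=
  hausdorff_dist (X i) Y @[i --> \oo] --> (0 : \bar R)%E.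

Definition convergent_matrices {n : nat -> nat} (S : forall i, 'M[R]_(n i)) :=
  exists c : R, [/\ 0 < c, forall i, entry_sum (S i) < c &
    forall k, (0 < k)%N -> exists Y : set 'M[R]_k,
      [/\ closed Y, (forall M, Y M -> forall a b, 0 <= M a b <= c) &
          hausdorff_cvg (fun i => matrix_shape (S i) k) Y]].

End matrix_shapes.

Section measure_shapes.
Context {R : realType}.
Implicit Type mu : {measure set (borel (cantor_space * cantor_space)%type) -> \bar R}.

Definition symmetric_measure mu :=
  forall A : set (borel (cantor_space * cantor_space)%type), measurable A ->
    mu ((fun p => (p.2, p.1)) @^-1` A) = mu A.

Definition fractional_partition {k} (f : 'I_k -> borel cantor_space -> R) :=
  [/\ forall i, measurable_fun [set: borel cantor_space] (f i),
      forall i x, 0 <= f i x,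
      forall x, \sum_i f i x = 1 &
      forall i, (\int[fair_coin R]_x (f i x)%:E = (k%:R^-1)%:E)%E].

Definition measure_shape0 mu (k : nat) : set 'M[R]_k :=
  [set M | exists2 f, fractional_partition f &
    forall i j, ((M i j)%:E = \int[mu]_p (f i p.1 * f j p.2)%:E)%E].

Definition measure_shape mu (k : nat) : set 'M[R]_k :=
  closure (measure_shape0 mu k).

End measure_shapes.

(* Main.v *)
Require Import Defs.
From mathcomp Require Import all_boot all_order all_algebra.
From mathcomp Require Import all_classical all_reals all_analysis.
From mathcomp Require Import measurable_realfun ring lra zify.
Set Implicit Arguments.
Unset Strict Implicit.
Unset Printing Implicit Defensive.
Import Order.TTheory GRing.Theory Num.Theory.
Import numFieldNormedType.Exports.
Local Open Scope classical_set_scope.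
Local Open Scope ring_scope.

(** The proof replaces both the matrices and the measure by finite data.  A family
    [P] with [balanced P] is a point of K(k, n), and [coarsen A P] is the matrix
    P A P^T, so that the k-shape of A is the set of all [coarsen A P].  Since products of
    balanced families are balanced, every limit shape is stable under coarsening.

    Identify a string of m bits with the cylinder it defines in Cantor space.  A
    nonnegative function [a] on pairs of strings of equal length that is additive under
    subdivision is the same thing as a finite measure mu on the square, through
    mu (box s t) = a s t, and [coarsen a F], for F balanced over the strings of
    length m, is the matrix of mu on the step functions F.  So it suffices to find a tree [a]
    such that

    - at every level m, the 2^m x 2^m matrix of [a] lies in the limit of the
      2^m-shapes: then every step matrix of mu lies in the limit of the k-shapes, and
      Borel partitions are limits of step functions ([step_approximation]);
    - every matrix of the limit of the k-shapes is approximated by step matrices of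
      [a], at a sufficiently deep level.

    Such a tree is built level by level ([limit_tree]), treating in turn the members of a
    countable dense family of target matrices.  The heart of the matter is the single
    step, [refine_partition]: given a partition P of n indices into 2^m fractional parts
    of equal size and any other balanced M, the parts of P are subdivided
    into 2^N equal subparts in such a way that M becomes, up to a small error, a
    function of the subpart.  The point is that N depends only on the error and on the number of parts of M,
    neither on n nor on the matrices, and that the error is small at every index: the mass
    of the matrices may well sit on a negligible set of indices.  The values of M are rounded to
    finitely many colours and each part is distributed over its subparts almost
    colour by colour ([color_kernel]).  A compactness argument passes this step to the
    limit ([refine_limit]); convergence of the whole sequence of shapes is used to
    turn cluster points into limits ([limit_shape_frequently]). *)

(** * Balanced families and equidistribution *)

Section balanced.
Variable R : realType.
Implicit Types I J K : finType.

(** The matrices of K(#|I|, #|J|), indexed by arbitrary finite types. *)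
Definition balanced I J (P : I -> J -> R) :=
  [/\ forall i j, 0 <= P i j,
      forall i, \sum_j P i j = #|J|%:R / #|I|%:R &
      forall j, \sum_i P i j = 1].

(** The matrix P A P^T. *)
Definition coarsen I J (A : J -> J -> R) (P : I -> J -> R) : I -> I -> R :=
  fun u v => \sum_a \sum_b P u a * A a b * P v b.

Lemma balanced_le1 I J (P : I -> J -> R) i j : balanced P -> P i j <= 1.
Proof.
case=> P0 _ /(_ j) <-; rewrite (bigD1 i)//= lerDl.
by apply: sumr_ge0 => ? _; exact: P0.
Qed.

Lemma balanced_comp I J K (F : I -> J -> R) (P : J -> K -> R) : (0 < #|J|)%N ->
  balanced F -> balanced P -> balanced (fun i x => \sum_j F i j * P j x).
Proof.
move=> J0 [F0 F1 F2] [P0 P1 P2]; split.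
- by move=> i x; apply: sumr_ge0 => j _; rewrite mulr_ge0.
- move=> i; rewrite exchange_big/=; under eq_bigr do rewrite -mulr_sumr P1.
  by rewrite -mulr_suml F1 mulrC mulrA divfK// pnatr_eq0; lia.
- move=> x; rewrite exchange_big/=; under eq_bigr do rewrite -mulr_suml F2 mul1r.
  exact: P2.
Qed.

Lemma coarsen_comp I J K (A : K -> K -> R) (P : J -> K -> R) (F : I -> J -> R) u v :
  coarsen (coarsen A P) F u v = coarsen A (fun i x => \sum_j F i j * P j x) u v.
Proof.
rewrite /coarsen.
transitivity (\sum_a \sum_b \sum_x \sum_y F u a * P a x * A x y * (F v b * P b y)).
  apply: eq_bigr => a _; apply: eq_bigr => b _.
  rewrite mulr_sumr mulr_suml; apply: eq_bigr => x _.
  rewrite mulr_sumr mulr_suml; apply: eq_bigr => y _; ring.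
under eq_bigr do rewrite exchange_big/=.
rewrite exchange_big/=; apply: eq_bigr => x _.
under eq_bigr do rewrite exchange_big/=.
rewrite exchange_big/=; apply: eq_bigr => y _.
rewrite [RHS]mulr_sumr exchange_big/=; apply: eq_bigr => b _.
by rewrite -!mulr_suml.
Qed.

Lemma coarsen_ge0 I J (A : J -> J -> R) (P : I -> J -> R) u v :
  (forall a b, 0 <= A a b) -> (forall i j, 0 <= P i j) -> 0 <= coarsen A P u v.
Proof.
move=> A0 P0; apply: sumr_ge0 => a _; apply: sumr_ge0 => b _.
by rewrite !mulr_ge0.
Qed.

Lemma coarsen_le I J (A : J -> J -> R) (P : I -> J -> R) u v :
  (forall a b, 0 <= A a b) -> balanced P -> coarsen A P u v <= \sum_a \sum_b A a b.
Proof.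
move=> A0 bP; have P0 i j : 0 <= P i j by case: bP.
apply: ler_sum => a _; apply: ler_sum => b _.
rewrite -[leRHS]mulr1 ler_pM ?mulr_ge0 ?balanced_le1//.
by rewrite -[leRHS]mul1r ler_wpM2r ?balanced_le1.
Qed.

Lemma coarsen_sym I J (A : J -> J -> R) (P : I -> J -> R) u v :
  (forall a b, A a b = A b a) -> coarsen A P u v = coarsen A P v u.
Proof.
move=> As; rewrite /coarsen exchange_big/=; apply: eq_bigr => a _.
by apply: eq_bigr => b _; rewrite (As b a); ring.
Qed.

Lemma coarsen_close I J (A : J -> J -> R) (P Q : I -> J -> R) e u v :
  (forall a b, 0 <= A a b) -> balanced P -> balanced Q ->
  (forall i j, `|P i j - Q i j| <= e) ->
  `|coarsen A P u v - coarsen A Q u v| <= 2 * e * \sum_a \sum_b A a b.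
Proof.
move=> A0 bP bQ PQ; have P0 i j : 0 <= P i j by case: bP.
have Q0 i j : 0 <= Q i j by case: bQ.
rewrite /coarsen -sumrB mulr_sumr; apply: le_trans (ler_norm_sum _ _ _) _.
apply: ler_sum => a _; rewrite -sumrB mulr_sumr.
apply: le_trans (ler_norm_sum _ _ _) _; apply: ler_sum => b _.
rewrite [X in `|X|](_ : _ = ((P u a - Q u a) * P v b + Q u a * (P v b - Q v b)) * A a b);
  last by ring.
rewrite normrM (ger0_norm (A0 _ _)) ler_wpM2r// mulr_natl mulr2n.
apply: le_trans (ler_normD _ _) _; rewrite !normrM.
rewrite (ger0_norm (P0 _ _)) (ger0_norm (Q0 _ _)) lerD//.
  by rewrite -[leRHS]mulr1 ler_pM ?balanced_le1.
by rewrite -[leRHS]mul1r ler_pM ?balanced_le1.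
Qed.

Lemma coarsen_closeA I J (A B : J -> J -> R) (P : I -> J -> R) e u v :
  balanced P -> (forall a b, `|A a b - B a b| <= e) ->
  `|coarsen A P u v - coarsen B P u v| <= #|J|%:R ^+ 2 * e.
Proof.
move=> bP AB; have P0 i j : 0 <= P i j by case: bP.
rewrite [leRHS](_ : _ = \sum_(a : J) \sum_(b : J) e); last first.
  by rewrite !sumr_const -[e *+ _]mulr_natl -[RHS]mulr_natl; ring.
rewrite /coarsen -sumrB; apply: le_trans (ler_norm_sum _ _ _) _.
apply: ler_sum => a _; rewrite -sumrB.
apply: le_trans (ler_norm_sum _ _ _) _; apply: ler_sum => b _.
rewrite -mulrBl -mulrBr !normrM !(ger0_norm (P0 _ _)).
rewrite -[leRHS]mulr1 ler_pM ?mulr_ge0 ?balanced_le1//.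
by rewrite -[leRHS]mul1r ler_pM ?balanced_le1.
Qed.

(** The correction shrinks F by 1 - #|I| t and adds to each row the constant
    that restores its average; the shrinking makes these constants nonnegative. *)
Lemma rebalance I J (F : I -> J -> R) (t : R) : (0 < #|I|)%N -> (0 < #|J|)%N ->
  (forall i j, 0 <= F i j) -> (forall j, \sum_i F i j = 1) ->
  (forall i, `|\sum_j F i j - #|J|%:R / #|I|%:R| <= t * #|J|%:R) ->
  #|I|%:R * t <= 1 ->
  exists2 G, balanced G & forall i j, `|G i j - F i j| <= #|I|%:R * t.
Proof.
move=> I0 J0 F0 F1 Ft kt1; set k := #|I|%:R * t.
have I0' : 0 < #|I|%:R :> R by rewrite ltr0n.
have J0' : 0 < #|J|%:R :> R by rewrite ltr0n.
have /card_gt0P[i0 _] := I0.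
have t0 : 0 <= t by rewrite -(pmulr_lge0 _ J0'); exact: le_trans (Ft i0).
have k0 : 0 <= k by rewrite mulr_ge0// ler0n.
pose r i := (\sum_j F i j) / #|J|%:R.
pose c i := #|I|%:R^-1 - (1 - k) * r i.
have c0 i : 0 <= c i.
  have /ler_normlP[_] := Ft i.
  rewrite lerBlDl => Fi; rewrite subr_ge0.
  have ri : r i <= #|I|%:R^-1 + t by rewrite ler_pdivrMr// mulrDl mulrC.
  apply: (@le_trans _ _ ((1 - k) * (#|I|%:R^-1 + t))); first by rewrite ler_wpM2l// subr_ge0.
  rewrite [leLHS](_ : _ = #|I|%:R^-1 - k * t).
    by rewrite lerBlDr lerDl mulr_ge0.
  by rewrite /k; field; rewrite pnatr_eq0; lia.
have sumr : \sum_i r i = 1.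
  rewrite -mulr_suml exchange_big/= (eq_bigr (fun=> 1)); last by [].
  by rewrite sumr_const divff// gt_eqF.
have sumc : \sum_i c i = k.
  rewrite sumrB -mulr_sumr sumr sumr_const -[X in X - _]mulr_natl divff ?gt_eqF//.
  by ring.
have F_le1 i j : F i j <= 1.
  by rewrite -(F1 j) (bigD1 i)//= lerDl; apply: sumr_ge0.
have c_lek i : c i <= k.
  by rewrite -sumc (bigD1 i)//= lerDl; apply: sumr_ge0.
exists (fun i j => (1 - k) * F i j + c i).
  split=> [i j|i|j].
  - by rewrite addr_ge0// mulr_ge0// subr_ge0.
  - rewrite big_split/= -mulr_sumr sumr_const -mulr_natl /c /r; field.
    by rewrite !pnatr_eq0; lia.
  - by rewrite big_split/= -mulr_sumr F1 sumc; ring.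
move=> i j; rewrite [X in `|X|](_ : _ = c i - k * F i j); last by ring.
rewrite ler_norml; apply/andP; split.
  have : k * F i j <= k by rewrite ler_piMr.
  by have := c0 i; lra.
have : 0 <= k * F i j by rewrite mulr_ge0.
by have := c_lek i; lra.
Qed.

(** The disjoint sum of the types 'I_(p g) embeds into T. *)
Lemma color_fibres (C T : finType) (g0 : C) (p : C -> nat) :
  (\sum_g p g <= #|T|)%N ->
  exists col : T -> C, forall g, (p g <= #|[set t | col t == g]%SET|)%N.
Proof.
move=> pT; pose X := {g : C & 'I_(p g)}.
have XT : (#|{: X}| <= #|T|)%N.
  rewrite card_tagged sumnE big_map big_enum/=.
  by under eq_bigr do rewrite card_ord.
pose f (x : X) : T := enum_val (widen_ord XT (enum_rank x)).
have f_inj : injective f.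
  move=> x y /enum_val_inj/(congr1 val)/= /val_inj; exact: enum_rank_inj.
exists (fun t => if [pick x | f x == t] is Some x then tag x else g0) => g.
rewrite -[leqLHS]card_ord.
have h_inj : injective (fun i : 'I_(p g) => f (Tagged (fun g => 'I_(p g)) i)).
  by move=> i j /f_inj /eqP; rewrite eq_Tagged/= => /eqP.
rewrite -(card_imset predT h_inj); apply/subset_leq_card/fintype.subsetP => _ /imsetP[i _ ->].
rewrite inE; case: pickP => [x /eqP /f_inj ->//|/(_ (Tagged (fun g => 'I_(p g)) i))].
by rewrite eqxx.
Qed.

(** Mass W g of colour g has to be spread over containers t of equal capacity,
    nearly all of it into containers reserved for its own colour, with a loss d that
    does not depend on how small W g is.  Colour g gets at least one container, and
    enough of them to hold the proportion 1 - d of its mass, which is possible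
    because rounding up costs at most #|C| containers.  The proportion d of
    every colour is then poured into whatever capacity remains. *)
Lemma color_kernel (C T : finType) (W : C -> R) (d : R) :
  0 < d <= 1 -> (forall g, 0 <= W g) -> 0 < \sum_g W g ->
  #|C|%:R <= d * #|T|%:R ->
  exists (col : T -> C) (h : T -> C -> R),
    [/\ forall t g, 0 <= h t g,
        forall g, \sum_t h t g = 1,
        forall t, \sum_g h t g * W g = (\sum_g W g) / #|T|%:R &
        forall g, \sum_(t | col t != g) h t g <= d].
Proof.
move=> /andP[d0 d1] W0; set w := \sum_g W g => w0 CT.
have [g0 _] : exists g : C, true.
  case: (pickP (fun _ : C => true)) => [g _|C0]; first by exists g.
  by move: w0; rewrite /w big_pred0 ?ltxx.
have T0 : 0 < #|T|%:R :> R.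
  have : 0 < #|C|%:R :> R by rewrite ltr0n; apply/card_gt0P; exists g0.
  by move=> C0; rewrite -(pmulr_rgt0 _ d0); exact: lt_le_trans CT.
pose x g := (1 - d) * #|T|%:R * W g / w.
have x0 g : 0 <= x g.
  by rewrite /x !mulr_ge0 ?invr_ge0 ?subr_ge0 ?(ltW w0).
have [|col colP] := @color_fibres C T g0 (fun g => (Num.truncn (x g)).+1).
  rewrite -(ler_nat R) natr_sum.
  apply: (@le_trans _ _ (\sum_g (x g + 1))).
    apply: ler_sum => g _; rewrite -natr1 lerD2r.
    by have /andP[] := truncn_itv (x0 g).
  rewrite big_split/= sumr_const -mulr_suml -mulr_sumr mulfK ?gt_eqF//.
  lra.
pose p g : R := #|[set t | col t == g]%SET|%:R.
have xp g : x g < p g.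
  apply: lt_le_trans (_ : (Num.truncn (x g)).+1%:R <= _); last by rewrite ler_nat.
  by have /andP[] := truncn_itv (x0 g).
have p0 g : 0 < p g by apply: le_lt_trans (xp g).
(* the capacity of container t left free by the mass of its own colour *)
pose rho t := w / #|T|%:R - (1 - d) * W (col t) / p (col t).
have rho0 t : 0 <= rho t.
  rewrite /rho subr_ge0 ler_pdivrMr// mulrAC ler_pdivlMr//.
  have := xp (col t); rewrite /x ltr_pdivrMr// => /ltW.
  by rewrite mulrAC [p _ * _]mulrC.
have sump (f : C -> R) : \sum_t f (col t) = \sum_g p g * f g.
  rewrite (partition_big col predT)//=; apply: eq_bigr => g _.
  rewrite (eq_bigr (fun=> f g)); last by move=> t /eqP ->.
  by rewrite sumr_const mulr_natl /p cardsE.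
have sumrho : \sum_t rho t = d * w.
  rewrite sumrB sumr_const -mulr_natl (sump (fun g => (1 - d) * W g / p g)).
  rewrite (eq_bigr (fun g => (1 - d) * W g)).
    by rewrite -mulr_sumr -/w; field; rewrite gt_eqF.
  by move=> g _; rewrite mulrC divfK ?gt_eqF.
pose h t g := (1 - d) * (col t == g)%:R / p g + rho t / w.
exists col, h; split.
- move=> t g; rewrite /h addr_ge0//.
    by rewrite !mulr_ge0// ?subr_ge0// invr_ge0 ltW.
  by rewrite mulr_ge0// invr_ge0 ltW.
- move=> g; rewrite big_split/= -mulr_suml -mulr_sumr.
  rewrite (sump (fun g' => (g' == g)%:R)) (bigD1 g)//= big1; last first.
    by move=> i /negbTE ->; rewrite mulr0.
  rewrite eqxx/= -mulr_suml sumrho mulr1 addr0 !mulfK ?gt_eqF//; ring.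
- move=> t; rewrite (eq_bigr (fun g =>
     (1 - d) * (W g / p g) * (col t == g)%:R + rho t / w * W g)).
    rewrite big_split/= -mulr_sumr -/w (bigD1 (col t))//= big1; last first.
      by move=> g; rewrite eq_sym => /negbTE ->; rewrite mulr0.
    by rewrite eqxx mulr1 addr0 /rho mulrA mulfVK ?gt_eqF//; ring.
  by move=> g _; rewrite /h; ring.
- move=> g; apply: (@le_trans _ _ (\sum_t rho t / w)).
    rewrite [leRHS](bigID (fun t => col t != g))/= -[leLHS]addr0 lerD//.
      by apply: ler_sum => t /negbTE tg; rewrite /h tg mulr0 mul0r add0r.
    by apply: sumr_ge0 => t _; rewrite mulr_ge0// invr_ge0 ltW.
  by rewrite -mulr_suml sumrho mulfK ?gt_eqF.
Qed.

Definition simplex k (v : 'I_k -> R) := (forall l, 0 <= v l) /\ \sum_l v l = 1.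

(** Two points whose coordinates have the same integer parts after scaling by N are
    1 / N close, so one representative per occupied cell forms a net. *)
Lemma simplex_net k (e : R) : (0 < k)%N -> 0 < e ->
  exists (C : finType) (rep : C -> 'I_k -> R), (forall g, simplex (rep g)) /\
    forall v, simplex v -> exists g, forall l, `|rep g l - v l| <= e.
Proof.
move=> k0 e0; pose N := (Num.truncn e^-1).+1.
have N0 : 0 < N%:R :> R by rewrite ltr0n.
have Ne : N%:R^-1 <= e.
  rewrite -[leRHS]invrK lef_pV2 ?posrE ?invr_gt0// ltW//.
  by have /truncn_itv/andP[] : 0 <= e^-1 by rewrite invr_ge0 ltW.
pose cell (v : 'I_k -> R) : {ffun 'I_k -> 'I_N.+1} :=
  [ffun l => inord (Num.truncn (N%:R * v l))].
have v1 : simplex (fun _ : 'I_k => k%:R^-1).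
  split=> [l|]; first by rewrite invr_ge0.
  by rewrite sumr_const card_ord/= -[LHS]mulr_natl divff// pnatr_eq0; lia.
have cellP v v' : simplex v -> simplex v' -> cell v = cell v' ->
    forall l, `|v l - v' l| <= e.
  have vle (u : 'I_k -> R) l : simplex u -> 0 <= u l <= 1.
    case=> u0 <-; rewrite u0/= (bigD1 l)//= lerDl; exact: sumr_ge0.
  have tle (u : 'I_k -> R) l : simplex u -> (Num.truncn (N%:R * u l) < N.+1)%N.
    move=> /vle - /(_ l) /andP[u0 u1]; rewrite ltnS truncn_le_nat.
    by rewrite -natr1 mulrC; apply: le_lt_trans (_ : N%:R < _); rewrite ?ltrDl// ler_piMl.
  move=> vS vS' /ffunP vv' l; have := vv' l; rewrite !ffunE => /(congr1 val).
  rewrite /= !inordK ?tle// => tt.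
  have /andP[a0 _] := vle _ l vS; have /andP[b0 _] := vle _ l vS'.
  have /andP[a1 a2] := truncn_itv (mulr_ge0 (ltW N0) a0).
  have /andP[b1 b2] := truncn_itv (mulr_ge0 (ltW N0) b0).
  apply: le_trans Ne; rewrite -(ler_pM2l N0) divff ?gt_eqF//.
  rewrite -{1}(ger0_norm (ltW N0)) -normrM ler_norml.
  by move: a1 a2 b1 b2; rewrite tt -natr1 mulrBr => *; apply/andP; split; lra.
pose rep g := if pselect (exists v, simplex v /\ cell v = g) is left H
  then projT1 (cid H) else fun=> k%:R^-1.
exists {ffun 'I_k -> 'I_N.+1}, rep; split=> [g|v vS].
  by rewrite /rep; case: pselect => // H; case: cid => v [].
exists (cell v) => l; rewrite /rep; case: pselect => [H|]; last by case; exists v.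
by case: cid => u /= [uS uv]; exact: cellP.
Qed.

End balanced.

(** * Refining a partition along binary strings *)

Section strings.
Variable R : realType.

Lemma sum_tuple_cat (V : nmodType) m N (G : seq bool -> V) :
  \sum_(s : (m + N).-tuple bool) G s =
  \sum_(u : m.-tuple bool) \sum_(t : N.-tuple bool) G (u ++ t).
Proof.
rewrite pair_big/= (reindex (fun p : m.-tuple bool * N.-tuple bool => cat_tuple p.1 p.2))//.
apply: onW_bij; apply: inj_card_bij => [[u t] [u' t']|].
  move=> /(congr1 val)/= /eqP; rewrite eqseq_cat ?size_tuple// => /andP[/eqP uu /eqP tt].
  by congr pair; exact: val_inj.
by rewrite card_prod !card_tuple expnD.
Qed.

(** [N] is chosen before [m], [n], [P] and [M]; this uniformity is what allows the
    passage to the limit.  Within the part u of P, index a carries the mass P u a and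
    the colour of M(., a), and [color_kernel] distributes it over the strings that
    extend u.  Reading off the colour reserved for each string gives F0, which
    recovers M at every index up to the rounding error and the proportion of mass that
    went to a foreign colour. *)
Lemma refine_partition k (e : R) : (0 < k)%N -> 0 < e <= 1 ->
  exists2 N, (0 < N)%N & forall m n (P : seq bool -> 'I_n -> R) (M : 'I_k -> 'I_n -> R),
    (0 < n)%N -> balanced (fun u : m.-tuple bool => P u) -> balanced M ->
    exists (Q : seq bool -> 'I_n -> R) (F : 'I_k -> (m + N).-tuple bool -> R),
      [/\ balanced (fun s : (m + N).-tuple bool => Q s),
          forall (u : m.-tuple bool) a, \sum_(t : N.-tuple bool) Q (u ++ t) a = P u a,
          balanced F &
          forall l a, `|\sum_s F l s * Q s a - M l a| <= e].
Proof.
move=> k0 /andP[e0 e1].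
have k0' : 1 <= k%:R :> R by rewrite ler1n.
(* rounding and leakage cost d each, and rebalancing costs k (d + d) *)
pose d := e / (4 * k%:R).
have d0 : 0 < d by rewrite divr_gt0// mulr_gt0//; lra.
have dke : k%:R * (d + d) = e / 2 by rewrite /d; field; rewrite gt_eqF//; lra.
have dde : d + d <= e / 2.
  by rewrite -dke -[leLHS]mul1r ler_wpM2r//; lra.
have [C [rep [repS repP]]] := simplex_net k0 d0.
exists (Num.truncn (#|C|%:R / d)).+1 => //; set N := (Num.truncn _).+1.
have CN : #|C|%:R <= d * (2 ^ N)%:R :> R.
  rewrite mulrC -ler_pdivrMr//; apply: (@le_trans _ _ N%:R).
    by rewrite ltW// -truncn_le_nat.
  by rewrite ler_nat ltnW// ltn_expl.
move=> m n P M n0 bP bM; have [P0' P1 P2] := bP; have [M0 M1 M2] := bM.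
have P0 (u : m.-tuple bool) a : 0 <= P u a by exact: P0'.
have n0' : 0 < n%:R :> R by rewrite ltr0n.
have /choice[c cP] : forall a, exists g, forall l, `|rep g l - M l a| <= d.
  by move=> a; apply: (repP (M^~ a)); split.
have sumW (u : m.-tuple bool) : \sum_g (\sum_(a | c a == g) P u a) = n%:R / (2 ^ m)%:R.
  have := P1 u; rewrite card_ord card_tuple card_bool => <-.
  by rewrite (partition_big c predT).
have m0 : 0 < (2 ^ m)%:R :> R by rewrite ltr0n expn_gt0.
have /choice[col] : forall u : m.-tuple bool,
    exists (col : N.-tuple bool -> C), exists h : N.-tuple bool -> C -> R,
    [/\ forall t g, 0 <= h t g,
        forall g, \sum_t h t g = 1,
        forall t, \sum_g h t g * (\sum_(a | c a == g) P u a) = n%:R / (2 ^ m)%:R / (2 ^ N)%:R &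
        forall g, \sum_(t | col t != g) h t g <= d].
  move=> u; have [||||col [h [h0 h1 h2 h3]]] :=
    @color_kernel _ C (N.-tuple bool) (fun g => \sum_(a | c a == g) P u a) d.
  - by rewrite d0/=; lra.
  - by move=> g; apply: sumr_ge0 => a _; exact: P0.
  - by rewrite sumW divr_gt0.
  - by rewrite card_tuple card_bool.
  exists col, h; split=> // t; rewrite h2 sumW.
  by rewrite card_tuple card_bool.
move=> /choice[h hP].
have h0 u t g : 0 <= h u t g by have [] := hP u.
(* the two halves of a string of length m + N, as tuples *)
pose pre (s : seq bool) : m.-tuple bool := insubd [tuple of nseq m false] (take m s).
pose suf (s : seq bool) : N.-tuple bool := insubd [tuple of nseq N false] (drop m s).
have preE (u : m.-tuple bool) t : pre (u ++ t) = u.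
  by rewrite /pre take_size_cat ?size_tuple// valKd.
have sufE (u : m.-tuple bool) (t : N.-tuple bool) : suf (u ++ t) = t.
  by rewrite /suf drop_size_cat ?size_tuple// valKd.
pose Q (s : seq bool) a : R := P (pre s) a * h (pre s) (suf s) (c a).
pose F0 (l : 'I_k) (s : seq bool) : R := rep (col (pre s) (suf s)) l.
have QE (u : m.-tuple bool) (t : N.-tuple bool) a : Q (u ++ t) a = P u a * h u t (c a).
  by rewrite /Q preE sufE.
have F0E l (u : m.-tuple bool) (t : N.-tuple bool) : F0 l (u ++ t) = rep (col u t) l.
  by rewrite /F0 preE sufE.
have Qsum (u : m.-tuple bool) a : \sum_(t : N.-tuple bool) Q (u ++ t) a = P u a.
  under eq_bigr do rewrite QE.
  by rewrite -mulr_sumr; have [_ -> _ _] := hP u; rewrite mulr1.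
have Q0 s a : 0 <= Q s a by rewrite mulr_ge0//; exact: P0.
have Q1 (s : (m + N).-tuple bool) : \sum_a Q s a = n%:R / (2 ^ (m + N))%:R.
  have [_ _ h2 _] := hP (pre s).
  rewrite expnD natrM invfM mulrA -(h2 (suf s)).
  rewrite (partition_big c predT)//=; apply: eq_bigr => g _.
  by rewrite mulr_sumr; apply: eq_bigr => a /eqP <-; rewrite mulrC.
have Q2 a : \sum_(s : (m + N).-tuple bool) Q s a = 1.
  rewrite (sum_tuple_cat _ _ (Q^~ a)); under eq_bigr do rewrite Qsum.
  exact: P2.
have bQ : balanced (fun s : (m + N).-tuple bool => Q s).
  split=> [s a|s|a]; first exact: Q0.
    by rewrite Q1 card_ord card_tuple card_bool.
  exact: Q2.
have F00 l s : 0 <= F0 l s by exact: (repS _).1.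
have F01 s : \sum_l F0 l s = 1 by exact: (repS _).2.
have F0le l s : F0 l s <= 1.
  by rewrite -(F01 s) (bigD1 l)//= lerDl; apply: sumr_ge0.
have FQ l a : `|\sum_(s : (m + N).-tuple bool) F0 l s * Q s a - M l a| <= d + d.
  rewrite -[M l a]mul1r -(Q2 a) mulr_suml -sumrB.
  apply: le_trans (ler_norm_sum _ _ _) _.
  rewrite (sum_tuple_cat _ _ (fun s => `|F0 l s * Q s a - Q s a * M l a|)).
  apply: (@le_trans _ _ (\sum_(u : m.-tuple bool) P u a * (d + d))); last first.
    by rewrite -mulr_suml P2 mul1r.
  apply: ler_sum => u _; have [_ h1 _ h3] := hP u.
  apply: (@le_trans _ _ (\sum_(t : N.-tuple bool)
      P u a * (h u t (c a) * d + (col u t != c a)%:R * h u t (c a)))).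
    apply: ler_sum => t _; rewrite F0E QE [_ * M l a]mulrC -mulrBl normrM.
    rewrite (ger0_norm (mulr_ge0 (P0 _ _) (h0 _ _ _))).
    rewrite mulrCA ler_wpM2l ?P0//.
    rewrite [leLHS]mulrC.
    case: eqVneq => [->|ne] /=; first by rewrite mul0r addr0 ler_wpM2l.
    rewrite mul1r -[leLHS]add0r lerD// ?(mulr_ge0 _ (ltW d0))//.
    rewrite ler_piMr// ler_norml; have := F0le l (u ++ t); rewrite F0E.
    have := F00 l (u ++ t); rewrite F0E => ? ?.
    have := M0 l a; have := balanced_le1 l a bM => ? ?.
    by apply/andP; split; lra.
  rewrite -mulr_sumr ler_wpM2l ?P0//.
  rewrite big_split/= -mulr_suml h1 mul1r lerD2l.
  apply: le_trans (h3 (c a)); rewrite [leRHS]big_mkcond/=.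
  by apply: ler_sum => t _; case: ifP; rewrite ?mul1r ?mul0r.
have F0row l : `|\sum_(s : (m + N).-tuple bool) F0 l s - (2 ^ (m + N))%:R / k%:R|
    <= (d + d) * (2 ^ (m + N))%:R.
  set J := (2 ^ (m + N))%:R; have J0 : 0 < J :> R by rewrite ltr0n expn_gt0.
  have -> : \sum_(s : (m + N).-tuple bool) F0 l s - J / k%:R = J / n%:R *
      \sum_a (\sum_(s : (m + N).-tuple bool) F0 l s * Q s a - M l a).
    rewrite sumrB exchange_big/=.
    under [X in J / n%:R * (X - _)]eq_bigr do rewrite -mulr_sumr Q1.
    rewrite -mulr_suml M1 !card_ord -/J; field.
    by rewrite !gt_eqF//; lra.
  rewrite normrM ger0_norm ?divr_ge0 ?(ltW J0) ?(ltW n0')//.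
  rewrite [leRHS](_ : _ = J / n%:R * \sum_(a < n) (d + d)).
    rewrite ler_wpM2l ?divr_ge0 ?(ltW J0) ?(ltW n0')//.
    by apply: le_trans (ler_norm_sum _ _ _) _; apply: ler_sum => a _; exact: FQ.
  by rewrite sumr_const card_ord -[(d + d) *+ n]mulr_natl; field; rewrite gt_eqF.
have [||||||F bF FF0] := @rebalance R 'I_k ((m + N).-tuple bool) (fun l s => F0 l s) (d + d).
- by rewrite card_ord.
- by rewrite card_tuple card_bool expn_gt0.
- by move=> *; exact: F00.
- by move=> *; exact: F01.
- by move=> l; rewrite card_ord card_tuple card_bool.
- by rewrite card_ord dke; lra.
rewrite card_ord dke in FF0.
exists Q, F; split=> // l a.
have -> : \sum_s F l s * Q s a - M l a = \sum_(s : (m + N).-tuple bool) (F l s - F0 l s) * Q s a +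
   (\sum_(s : (m + N).-tuple bool) F0 l s * Q s a - M l a).
  rewrite addrA -big_split/=; congr (_ - _); apply: eq_bigr => s _; ring.
apply: le_trans (ler_normD _ _) _.
have : `|\sum_(s : (m + N).-tuple bool) (F l s - F0 l s) * Q s a| <= e / 2.
  rewrite [leRHS](_ : _ = e / 2 * \sum_(s : (m + N).-tuple bool) Q s a);
    last by rewrite Q2 mulr1.
  rewrite mulr_sumr; apply: le_trans (ler_norm_sum _ _ _) _.
  by apply: ler_sum => s _; rewrite normrM (ger0_norm (Q0 _ _)) ler_wpM2r ?Q0//; exact: FF0.
by have := FQ l a; lra.
Qed.

End strings.

(** * Hausdorff limits and compactness *)

Section hausdorff.
Variable R : realType.

Lemma ereal_cvg0_lt (u : nat -> \bar R) (e : R) : u i @[i --> \oo] --> (0 : \bar R)%E ->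
  0 < e -> exists N, forall i, (N <= i)%N -> (u i < e%:E)%E.
Proof.
move=> u0 e0.
have : nbhs (0 : \bar R)%E [set y | (y < e%:E)%E].
  by apply: open_nbhs_nbhs; split; [exact: open_ereal_lt_ereal|rewrite /= lte_fin].
by move=> /u0 [N _ NP]; exists N => i /NP.
Qed.

Lemma hausdorff_near k (X : nat -> set 'M[R]_k) (Y : set 'M[R]_k) (e : R) :
  hausdorff_cvg X Y -> 0 < e ->
  exists N, forall i, (N <= i)%N ->
    (forall A, X i A -> exists2 B, Y B & l1_dist A B < e) /\
    (forall B, Y B -> exists2 A, X i A & l1_dist A B < e).
Proof.
move=> XY e0; have [N NP] := ereal_cvg0_lt XY e0; exists N => i /NP.
rewrite /hausdorff_dist gt_max => /andP[XY1 XY2]; split.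
  move=> A XA.
  have /ereal_inf_lt[_ [B YB <-]] : (ereal_inf [set (l1_dist A B)%:E | B in Y] < e%:E)%E.
    by apply: le_lt_trans XY1; apply: ereal_sup_ubound; exists A.
  by rewrite lte_fin; exists B.
move=> B YB.
have /ereal_inf_lt[_ [A XA <-]] : (ereal_inf [set (l1_dist A B)%:E | A in X i] < e%:E)%E.
  by apply: le_lt_trans XY2; apply: ereal_sup_ubound; exists B.
by rewrite lte_fin; exists A.
Qed.

Lemma l1_dist_entry k (A B : 'M[R]_k) i j : `|A i j - B i j| <= l1_dist A B.
Proof.
rewrite /l1_dist (bigD1 i)//= (bigD1 j)//= -addrA lerDl addr_ge0//.
  by apply: sumr_ge0.
by apply: sumr_ge0 => ? _; apply: sumr_ge0.
Qed.

(** Bolzano-Weierstrass for functions on a finite type. *)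
Lemma bounded_cluster (J : finType) (x : nat -> J -> R) (c : R) :
  (forall i j, `|x i j| <= c) ->
  exists y : J -> R, forall e, 0 < e -> forall N, exists2 i, (N <= i)%N &
    forall j, `|x i j - y j| <= e.
Proof.
move=> xc; pose v i : 'rV[R]_#|J| := \row_l x i (enum_val l).
have /(_ (v @ \oo)) : compact [set u : 'rV[R]_#|J| | forall l, `[- c, c]%classic (u ord0 l)].
  exact: (@rV_compact R #|J| (fun=> `[- c, c]%classic) (fun=> @segment_compact R (- c) c)).
case=> [|y [_ /= cy]].
  by exists 0%N => // i _ l /=; rewrite mxE in_itv/= -ler_norml.
exists (fun j => y ord0 (enum_rank j)) => e e0 N.
have [_ [[i Ni <-] [_ yi]]] : [set v i | i in [set i | (N <= i)%N]] `&` ball y e !=set0.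
  apply: cy; last exact: nbhsx_ballx.
  by exists N => // i Ni; exists i.
exists i => // j; have := yi ord0 (enum_rank j).
by rewrite /= /v mxE enum_rankK distrC => /ltW.
Qed.

Lemma closure_entrywise k (Y : set 'M[R]_k) (B : 'M[R]_k) :
  closure Y B <-> forall e, 0 < e -> exists2 A, Y A & forall i j, `|A i j - B i j| <= e.
Proof.
split=> [clB e e0|YB U /nbhs_ballP[e /= e0 eU]].
  have [A [YA [_ BA]]] := clB _ (nbhsx_ballx B e e0).
  by exists A => // i j; rewrite distrC ltW//; exact: BA.
have [|A YA AB] := YB (e / 2); first by rewrite divr_gt0.
exists A; split=> //; apply: eU; split=> // i j.
rewrite /ball/= distrC; apply: le_lt_trans (AB i j) _.
by rewrite ltr_pdivrMr// ltr_pMr// ltr1n.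
Qed.

End hausdorff.

Lemma eq_of_close (R : realType) (a b C : R) :
  (forall e, 0 < e -> `|a - b| <= C * e) -> a = b.
Proof.
move=> abC; apply/eqP; rewrite -subr_eq0 -normr_le0; apply/ler_addgt0Pr => e e0.
rewrite add0r; pose D := `|C| + 1.
have D0 : 0 < D by rewrite ltr_wpDl.
apply: le_trans (abC (e / D) _) _; first by rewrite divr_gt0.
rewrite mulrA ler_pdivrMr// mulrC ler_wpM2l ?(ltW e0)// (le_trans (ler_norm _))//.
by rewrite lerDl.
Qed.

(** * Limits of shapes and the limit tree *)

Section limit_shapes.
Context (R : realType) (n : nat -> nat) (S : forall i, 'M[R]_(n i)) (c : R).
Hypothesis n_gt0 : forall i, (0 < n i)%N.
Hypothesis S_ge0 : forall i a b, 0 <= S i a b.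
Hypothesis S_sum : forall i, entry_sum (S i) <= c.
Hypothesis S_hausdorff : forall k, (0 < k)%N -> exists Y : set 'M[R]_k,
  hausdorff_cvg (fun i => matrix_shape (S i) k) Y.

(** Membership in the #|I|-shape of S i; see [attained_ord]. *)
Definition attained (I : finType) i (A : I -> I -> R) :=
  exists2 P : I -> 'I_(n i) -> R, balanced P &
    forall u v, coarsen (fun a b => S i a b) P u v = A u v.

(** For convergent sequences this is membership in the limit of the #|I|-shapes; see
    [limit_shapeP]. *)
Definition limit_shape (I : finType) (B : I -> I -> R) :=
  forall e, 0 < e -> exists N, forall i, (N <= i)%N ->
    exists2 A, attained i A & forall u v, `|A u v - B u v| <= e.

Lemma attained_comp (I J : finType) i (A : J -> J -> R) (F : I -> J -> R) :
  (0 < #|J|)%N -> balanced F -> attained i A -> attained i (coarsen A F).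
Proof.
move=> J0 bF [P bP PA]; exists (fun u a => \sum_j F u j * P j a).
  exact: balanced_comp.
move=> u v; rewrite -coarsen_comp; apply: eq_bigr => a _.
by apply: eq_bigr => b _; rewrite PA.
Qed.

Lemma attained_bij (I J : finType) i (A : J -> J -> R) (f : I -> J) :
  bijective f -> attained i A -> attained i (fun u v => A (f u) (f v)).
Proof.
move=> fB [P [P0 P1 P2] PA]; exists (fun u => P (f u)); last by move=> u v; exact: PA.
split=> [u a|u|a]; first exact: P0.
  by rewrite P1 (bij_eq_card fB).
by rewrite -(P2 a) [RHS](reindex f)//; exact: onW_bij.
Qed.

Lemma attained_bounds (I : finType) i (A : I -> I -> R) u v :
  attained i A -> 0 <= A u v <= c.
Proof.
move=> [P bP <-]; rewrite coarsen_ge0//=; last by case: bP.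
by apply: le_trans (S_sum i); exact: coarsen_le.
Qed.

Lemma attained_ord k i (A : 'M[R]_k) :
  attained i (fun u v => A u v) <-> matrix_shape (S i) k A.
Proof.
have mulE (M : 'M[R]_(k, n i)) u v :
    (M *m S i *m M^T) u v = coarsen (fun a b => S i a b) (fun u a => M u a) u v.
  rewrite mxE /coarsen exchange_big/=; apply: eq_bigr => b _.
  by rewrite !mxE mulr_suml.
split=> [[P [P0 P1 P2] PA]|[M [M0 M1 M2] <-]].
  exists (\matrix_(u, a) P u a); last first.
    apply/matrixP => u v; rewrite mulE -PA; apply: eq_bigr => a _.
    by apply: eq_bigr => b _; rewrite !mxE.
  split=> [u a|u|a]; first by rewrite mxE.
    by under eq_bigr do rewrite mxE; rewrite P1 !card_ord.
  by under eq_bigr do rewrite mxE.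
exists (fun u a => M u a); last by move=> u v; rewrite mulE.
by split=> // u; rewrite M1 !card_ord.
Qed.

Lemma limit_shape_comp (I J : finType) (A : J -> J -> R) (F : I -> J -> R) :
  (0 < #|J|)%N -> balanced F -> limit_shape A -> limit_shape (coarsen A F).
Proof.
move=> J0 bF Alim e e0; pose d := e / (#|J|%:R ^+ 2).
have J0' : 0 < #|J|%:R ^+ 2 :> R by rewrite exprn_gt0// ltr0n.
have [N NP] := Alim d (divr_gt0 e0 J0'); exists N => i /NP[B iB BA].
exists (coarsen B F); first exact: attained_comp.
move=> u v; apply: le_trans (coarsen_closeA _ _ bF BA) _.
by rewrite /d mulrC divfK ?gt_eqF.
Qed.

Lemma limit_shape_bij (I J : finType) (A : J -> J -> R) (f : I -> J) :
  bijective f -> limit_shape A -> limit_shape (fun u v => A (f u) (f v)).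
Proof.
move=> fB Alim e e0; have [N NP] := Alim e e0; exists N => i /NP[B iB BA].
by exists (fun u v => B (f u) (f v)) => //; exact: attained_bij.
Qed.

(** Convergence of the shapes enters here: being close to the shapes infinitely often means
    being close to their limit, hence to all late shapes. *)
Lemma limit_shape_frequently (I : finType) (B : I -> I -> R) : (0 < #|I|)%N ->
  (forall e, 0 < e -> forall N, exists2 i, (N <= i)%N &
    exists2 A, attained i A & forall u v, `|A u v - B u v| <= e) ->
  limit_shape B.
Proof.
move=> I0 Bfreq; have [Y SY] := S_hausdorff I0.
suff Blim : limit_shape (fun u v : 'I_#|I| => B (enum_val u) (enum_val v)).
  have /limit_shape_bij/(_ Blim) : bijective (@enum_rank I) by exact: enum_rank_bij.
  move=> Blim' e e0; have [N NP] := Blim' e e0; exists N => i /NP[A iA AB].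
  by exists A => // u v; have := AB u v; rewrite !enum_rankK.
move=> e e0; have e30 : 0 < e / 3 by lra.
have [N NP] := hausdorff_near SY e30; exists N => i Ni.
have [j Nj [A jA AB]] := Bfreq _ e30 N.
pose M : 'M[R]_#|I| := \matrix_(u, v) A (enum_val u) (enum_val v).
have /attained_ord jM : attained j (fun u v => M u v).
  have [P bP PA] := attained_bij (enum_val_bij I) jA.
  by exists P => // u v; rewrite PA mxE.
have [D YD MD] := (NP j Nj).1 _ jM.
have [E /attained_ord iE ED] := (NP i Ni).2 _ YD.
exists (fun u v => E u v) => // u v.
have := AB (enum_val u) (enum_val v); have := l1_dist_entry M D u v.
have := l1_dist_entry E D u v; rewrite [M u v]mxE.
set x := E u v; set y := D u v; set z := A _ _; set t := B _ _ => xy zy zt.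
rewrite (_ : x - t = (x - y) - (z - y) + (z - t)); last by ring.
apply: le_trans (ler_normD _ _) _; have := ler_normB (x - y) (z - y); lra.
Qed.

(** Here Y is closed, so a matrix approximated by late shapes belongs to it. *)
Lemma limit_shapeP k (Y : set 'M[R]_k) (B : 'M[R]_k) : (0 < k)%N ->
  closed Y -> hausdorff_cvg (fun i => matrix_shape (S i) k) Y ->
  limit_shape (fun u v => B u v) <-> Y B.
Proof.
move=> k0 cY SY; split=> [Blim|YB].
  rewrite ((closure_id Y).1 cY); apply/closure_entrywise => e e0.
  have e20 : 0 < e / 2 by lra.
  have [N NP] := Blim _ e20; have [N' N'P] := hausdorff_near SY e20.
  have [A iA AB] := NP _ (leq_maxl N N').
  have [D YD AD] : exists2 D, Y D & l1_dist (\matrix_(u, v) A u v) D < e / 2.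
    apply: (N'P _ (leq_maxr N N')).1; apply/attained_ord.
    by case: iA => P bP PA; exists P => // u v; rewrite PA mxE.
  exists D => // u v; have := l1_dist_entry (\matrix_(u, v) A u v) D u v.
  rewrite mxE distrC => DA; have := AB u v.
  rewrite (_ : D u v - B u v = (D u v - A u v) + (A u v - B u v)); last by ring.
  by have := ler_normD (D u v - A u v) (A u v - B u v); lra.
move=> e e0; have [N NP] := hausdorff_near SY e0; exists N => i /NP[_ /(_ _ YB)].
move=> [A /attained_ord iA AB]; exists (fun u v => A u v) => // u v.
by apply: le_trans (ltW AB); exact: l1_dist_entry.
Qed.

Lemma attained_cluster (I : finType) (z : nat -> I -> I -> R) : (0 < #|I|)%N ->
  (forall i, exists2 h, (i <= h)%N & attained h (z i)) ->
  exists2 B, limit_shape B & forall e, 0 < e -> forall N, exists2 i, (N <= i)%N &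
    forall u v, `|z i u v - B u v| <= e.
Proof.
move=> I0 zP; have [|y yP] := @bounded_cluster R (I * I)%type (fun i p => z i p.1 p.2) c.
  move=> i [u v]; have [h _ hz] := zP i.
  by have /andP[z0 zc] := attained_bounds u v hz; rewrite ger0_norm.
exists (fun u v => y (u, v)).
  apply: limit_shape_frequently => // e e0 N; have [i Ni zy] := yP e e0 N.
  have [h ih hz] := zP i; exists h; first exact: leq_trans ih.
  by exists (z i) => // u v; exact: (zy (u, v)).
move=> e e0 N; have [i Ni zy] := yP e e0 N.
by exists i => // u v; exact: (zy (u, v)).
Qed.

Definition limit_string_shape m (B : seq bool -> seq bool -> R) :=
  limit_shape (fun u v : m.-tuple bool => B u v).

Definition block_sum N (B : seq bool -> seq bool -> R) (s t : seq bool) : R :=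
  \sum_(p : N.-tuple bool) \sum_(q : N.-tuple bool) B (s ++ p) (t ++ q).

(** Coarsening by this family sums over all extensions of a string, so block sums are
    coarsenings and inherit all their properties. *)
Definition prefix_indic m N (u : m.-tuple bool) (s : (m + N).-tuple bool) : R :=
  (take m s == u)%:R.

Lemma sum_prefix_indic m N (u : m.-tuple bool) (G : seq bool -> R) :
  \sum_(s : (m + N).-tuple bool) prefix_indic u s * G s =
  \sum_(t : N.-tuple bool) G (u ++ t).
Proof.
rewrite /prefix_indic (sum_tuple_cat _ _ (fun s => (take m s == u)%:R * G s)) (bigD1 u)//=.
rewrite [X in _ + X]big1 ?addr0.
  by apply: eq_bigr => t _; rewrite take_size_cat ?size_tuple// eqxx mul1r.
move=> u' /negbTE uu'; apply: big1 => t _.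
by rewrite take_size_cat ?size_tuple// -[_ == _]/(u' == u) uu' mul0r.
Qed.

Lemma balanced_prefix m N : balanced (@prefix_indic m N).
Proof.
split=> [u s|u|s]; first exact: ler0n.
  under eq_bigr do rewrite -[prefix_indic _ _]mulr1.
  rewrite (sum_prefix_indic _ _ (fun=> 1)) sumr_const !card_tuple card_bool expnD natrM.
  by rewrite mulrAC divff ?mul1r// pnatr_eq0 expn_eq0.
have sz : size (take m s) == m by rewrite size_takel// size_tuple leq_addr.
rewrite (bigD1 (Tuple sz))//= big1; first by rewrite /prefix_indic eqxx addr0.
move=> u /negbTE us; rewrite /prefix_indic eq_sym.
by rewrite -[_ == _]/(u == Tuple sz) us.
Qed.

Lemma coarsen_prefix m N (B : seq bool -> seq bool -> R) (u v : m.-tuple bool) :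
  coarsen (fun s t : (m + N).-tuple bool => B s t) (@prefix_indic m N) u v =
  block_sum N B u v.
Proof.
rewrite /coarsen; under eq_bigr do under eq_bigr do rewrite -mulrA [B _ _ * _]mulrC mulrA.
under eq_bigr => s _.
  under eq_bigr do rewrite -mulrA.
  rewrite -mulr_sumr (sum_prefix_indic _ _ (fun t => B s t)); over.
exact: (sum_prefix_indic _ _ (fun s => \sum_(t : N.-tuple bool) B s (v ++ t))).
Qed.

Lemma limit_string_shape_block m N B : limit_string_shape (m + N) B ->
  limit_string_shape m (block_sum N B).
Proof.
move=> Blim; have := limit_shape_comp _ (@balanced_prefix m N) Blim.
rewrite card_tuple card_bool expn_gt0 => /(_ isT).
by congr limit_shape; apply/funext => u; apply/funext => v; exact: coarsen_prefix.
Qed.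

(** [refine_partition] is applied to late matrices, with P and M nearly realising
    B and D.  The refined matrices have a cluster point, which is a limit shape,
    and the block sums, equal to those of P at each stage, converge to B exactly. *)
Lemma refine_limit m k (B : seq bool -> seq bool -> R) (D : 'I_k -> 'I_k -> R) (e : R) :
  (0 < k)%N -> 0 < e -> limit_string_shape m B -> limit_shape D ->
  exists2 N, (0 < N)%N & exists B', [/\ limit_string_shape (m + N) B',
    forall u v : m.-tuple bool, B u v = block_sum N B' u v &
    exists2 F : 'I_k -> (m + N).-tuple bool -> R, balanced F &
      forall i j, `|coarsen (fun s t : (m + N).-tuple bool => B' s t) F i j - D i j| <= e].
Proof.
move=> k0 e0 Blim Dlim.
have c0 : 0 <= c.
  by apply: le_trans (S_sum 0%N); do 2 apply: sumr_ge0 => ? _.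
(* a perturbation d of a balanced family moves a coarsening by at most 2 d c; the
   constant c + 1 avoids a division by zero *)
pose d := Num.min 1 (e / (4 * (c + 1))).
have d01 : 0 < d <= 1.
  by rewrite /d lt_min ltr01/= ge_min lexx/= andbT divr_gt0//; lra.
have dc : 2 * d * c <= e / 2.
  apply: (@le_trans _ _ (2 * (e / (4 * (c + 1))) * (c + 1))).
    by rewrite ler_pM ?mulr_ge0 ?ler_pM2l ?ge_min ?lexx ?orbT//; lra.
  by rewrite le_eqVlt; apply/orP; left; apply/eqP; field; rewrite gt_eqF//; lra.
have [N N0 refN] := refine_partition k0 d01.
exists N => //.
pose T := (m + N).-tuple bool.
pose small i : R := i.+1%:R^-1.
have small0 i : 0 < small i by rewrite invr_gt0.
have /choice[z zP] : forall i, exists z : T -> T -> R,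
  [/\ exists2 h, (i <= h)%N & attained h z,
      forall u v : m.-tuple bool, `|coarsen z (@prefix_indic m N) u v - B u v| <= small i &
      exists2 F : 'I_k -> T -> R, balanced F &
        forall x y, `|coarsen z F x y - D x y| <= e / 2 + small i].
  move=> i; have [N1 N1P] := Blim _ (small0 i); have [N2 N2P] := Dlim _ (small0 i).
  pose h := maxn i (maxn N1 N2).
  have [|A [P0 bP0 P0A] AB] := N1P h; first by rewrite /h !leq_max leqnn orbT.
  have [|A' [M bM MA'] A'D] := N2P h; first by rewrite /h !leq_max leqnn !orbT.
  pose P s := P0 (insubd [tuple of nseq m false] s).
  have PE : (fun u : m.-tuple bool => P u) = P0.
    by apply/funext => u; rewrite /P valKd.
  have bP : balanced (fun u : m.-tuple bool => P u) by rewrite PE.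
  have [Q [F [bQ QP bF FQ]]] := refN m (n h) P M (n_gt0 h) bP bM.
  pose z := coarsen (fun a b => S h a b) (fun s : T => Q s).
  exists z; split.
  - by exists h; [rewrite /h leq_maxl|exists (fun s : T => Q s)].
  - move=> u v; rewrite coarsen_comp.
    suff -> : (fun i x => \sum_j @prefix_indic m N i j * Q j x) = P0.
      by rewrite P0A; exact: AB.
    apply/funext => w; apply/funext => a.
    by rewrite (sum_prefix_indic _ _ (Q^~ a)) QP -PE.
  - exists F => // x y; rewrite coarsen_comp.
    rewrite (_ : _ - D x y = (coarsen (fun a b => S h a b) (fun l a => \sum_j F l j * Q j a) x y
       - A' x y) + (A' x y - D x y)); last by ring.
    apply: le_trans (ler_normD _ _) _; rewrite lerD//.
    apply: le_trans dc; rewrite -MA'.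
    have bFQ : balanced (fun l a => \sum_j F l j * Q j a).
      by apply: balanced_comp => //; rewrite card_tuple card_bool expn_gt0.
    apply: le_trans (coarsen_close x y (@S_ge0 h) bFQ bM FQ) _.
    by rewrite ler_wpM2l ?S_sum// mulr_ge0//; case/andP: d01 => /ltW.
have T0 : (0 < #|{: T}|)%N by rewrite card_tuple card_bool expn_gt0.
have [|B' B'lim zB'] := @attained_cluster T z T0; first by move=> i; have [] := zP i.
pose ext (s : seq bool) : T := insubd [tuple of nseq (m + N) false] s.
have extE : (fun s t : T => B' (ext s) (ext t)) = B'.
  by apply/funext => s; apply/funext => t; rewrite /ext !valKd.
have smallP f : 0 < f -> exists i0, forall i, (i0 <= i)%N -> small i <= f.
  move=> f0; exists (Num.truncn f^-1) => i i0.
  rewrite /small -[leRHS]invrK lef_pV2 ?posrE ?invr_gt0//.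
  apply: le_trans (ltW _) (_ : (Num.truncn f^-1).+1%:R <= _); last by rewrite ler_nat.
  by have /truncn_itv/andP[] : 0 <= f^-1 by rewrite invr_ge0 ltW.
exists (fun s t => B' (ext s) (ext t)); split.
- by rewrite /limit_string_shape extE.
- move=> u v; rewrite -coarsen_prefix extE.
  apply: (@eq_of_close R _ _ (1 + #|{: T}|%:R ^+ 2)) => f f0.
  have [i0 i0P] := smallP f f0; have [i ii0 zi] := zB' f f0 i0.
  have [_ zB _] := zP i; have := zB u v; have := i0P _ ii0.
  have := coarsen_closeA u v (balanced_prefix m N) zi.
  set x := coarsen _ _ _ _; set y := coarsen _ _ _ _ => xy sf xB.
  rewrite (_ : _ - y = - (x - B u v) + (x - y)); last by ring.
  apply: le_trans (ler_normD _ _) _; rewrite normrN; lra.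
- rewrite extE.
  have T20 : 0 < #|{: T}|%:R ^+ 2 :> R by rewrite exprn_gt0// ltr0n.
  pose f := e / 4 / #|{: T}|%:R ^+ 2.
  have f0 : 0 < f by rewrite divr_gt0//; lra.
  have e40 : 0 < e / 4 by lra.
  have [i0 i0P] := smallP _ e40; have [i ii0 zi] := zB' f f0 i0.
  have [_ _ [F bF FD]] := zP i; exists F => // x y.
  have := FD x y; have := i0P _ ii0; have := coarsen_closeA x y bF zi.
  rewrite (_ : #|{: T}|%:R ^+ 2 * f = e / 4); last by rewrite /f mulrC divfK ?gt_eqF.
  set p := coarsen _ _ _ _; set q := coarsen _ _ _ _ => pq sf pD.
  rewrite (_ : q - _ = - (p - q) + (p - D x y)); last by ring.
  apply: le_trans (ler_normD _ _) _; rewrite normrN; lra.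
Qed.

Lemma limit_shape_exists (I : finType) : (0 < #|I|)%N -> exists B : I -> I -> R, limit_shape B.
Proof.
move=> I0; have I0' : #|I|%:R != 0 :> R by rewrite pnatr_eq0 -lt0n.
pose P i (_ : I) (_ : 'I_(n i)) : R := #|I|%:R^-1.
have [|B Blim _] := @attained_cluster I (fun i => coarsen (fun a b => S i a b) (@P i)) I0;
  last by exists B.
move=> i; exists i => //; exists (@P i) => //; split=> [u a|u|a].
- by rewrite /P invr_ge0.
- by rewrite /P sumr_const -[LHS]mulr_natl.
- by rewrite /P sumr_const -[LHS]mulr_natl divff.
Qed.

Lemma limit_shape_ge0 (I : finType) (B : I -> I -> R) u v : limit_shape B -> 0 <= B u v.
Proof.
move=> Blim; rewrite leNgt; apply/negP => B0.
have e0 : 0 < - B u v / 2 by lra.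
have [N /(_ N (leqnn N))[A /(attained_bounds u v)/andP[A0 _] AB]] := Blim _ e0.
by have := AB u v; rewrite ler_norml => /andP[_]; lra.
Qed.

Lemma limit_shape_sym (I : finType) (B : I -> I -> R) u v :
  (forall i, (S i)^T = S i) -> limit_shape B -> B u v = B v u.
Proof.
move=> Ssym Blim; apply: (@eq_of_close R _ _ 2) => e e0.
have [N /(_ N (leqnn N))[A [P bP PA] AB]] := Blim _ e0.
have Auv : A u v = A v u.
  by rewrite -!PA; apply: coarsen_sym => a b; rewrite -[in LHS]Ssym mxE.
have := AB u v; have := AB v u; rewrite Auv => vu uv.
rewrite (_ : B u v - B v u = (A v u - B v u) - (A v u - B u v)); last by ring.
by apply: le_trans (ler_normB _ _) _; lra.
Qed.

Lemma block_sum0 B s t : block_sum 0 B s t = B s t.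
Proof.
have sum0 (G : seq bool -> R) : \sum_(p : 0.-tuple bool) G p = G [::].
  rewrite (bigD1 [tuple])//= big1 ?addr0// => p.
  by rewrite [p]tuple0 => /eqP.
rewrite /block_sum (sum0 (fun p => \sum_(q : 0.-tuple bool) B (s ++ p) (t ++ q))).
by rewrite (sum0 (fun q => B (s ++ [::]) (t ++ q))) !cats0.
Qed.

Lemma block_sumD M N B s t : block_sum (M + N) B s t = block_sum M (block_sum N B) s t.
Proof.
rewrite /block_sum.
rewrite (sum_tuple_cat _ _ (fun p => \sum_(q : (M + N).-tuple bool) B (s ++ p) (t ++ q))).
apply: eq_bigr => p1 _.
under eq_bigr => p2 _ do rewrite (sum_tuple_cat _ _ (fun q => B (s ++ p1 ++ p2) (t ++ q))).
rewrite exchange_big/=; apply: eq_bigr => q1 _; apply: eq_bigr => p2 _.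
by apply: eq_bigr => q2 _; rewrite !catA.
Qed.

Lemma eq_block_sum N A B s t :
  (forall p q : N.-tuple bool, A (s ++ p) (t ++ q) = B (s ++ p) (t ++ q)) ->
  block_sum N A s t = block_sum N B s t.
Proof. by move=> AB; apply: eq_bigr => p _; apply: eq_bigr => q _; exact: AB. Qed.

(** A rational k x k matrix together with a precision; there are countably many. *)
Definition rat_target := ({k : nat & {ffun 'I_k * 'I_k -> rat}} * nat)%type.

Definition captures m (B : seq bool -> seq bool -> R) (x : rat_target) :=
  exists2 F : 'I_(tag x.1) -> m.-tuple bool -> R, balanced F &
    forall i j, `|coarsen (fun s t : m.-tuple bool => B s t) F i j -
      ratr (tagged x.1 (i, j))| <= 2 / x.2.+1%:R.

Definition capturable (x : rat_target) :=
  exists D : 'I_(tag x.1) -> 'I_(tag x.1) -> R, [/\ (0 < tag x.1)%N, limit_shape D &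
    forall i j, `|D i j - ratr (tagged x.1 (i, j))| <= x.2.+1%:R^-1].

(** When x is not capturable the strings are lengthened all the same, so that the levels
    grow without bound along the construction. *)
Lemma refine_capture m B (o : option rat_target) : limit_string_shape m B ->
  exists2 N, (0 < N)%N & exists B', [/\ limit_string_shape (m + N) B',
    forall s t, size s = m -> size t = m -> B s t = block_sum N B' s t &
    forall x, o = Some x -> capturable x -> captures (m + N) B' x].
Proof.
move=> Blim.
have strings B' N : (forall u v : m.-tuple bool, B u v = block_sum N B' u v) ->
    forall s t, size s = m -> size t = m -> B s t = block_sum N B' s t.
  by move=> BB' s t /eqP sm /eqP tm; exact: (BB' (Tuple sm) (Tuple tm)).
case: (pselect (exists2 x, o = Some x & capturable x)) => [[x -> [D [k0 Dlim Dx]]]|nox].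
  have [|N N0 [B' [B'lim BB' [F bF FD]]]] := refine_limit (e := x.2.+1%:R^-1) k0 _ Blim Dlim.
    by rewrite invr_gt0.
  exists N => //; exists B'; split=> //; first exact: strings.
  move=> _ [<-] _; exists F => // i j.
  rewrite [X in `|X|](_ : _ = (coarsen (fun s t : (m + N).-tuple bool => B' s t) F i j - D i j) +
    (D i j - ratr (tagged x.1 (i, j)))); last by ring.
  by apply: le_trans (ler_normD _ _) _; rewrite mulr_natl mulr2n lerD.
have [|D Dlim] := @limit_shape_exists 'I_1; first by rewrite card_ord.
have [N N0 [B' [B'lim BB' _]]] := refine_limit (ltn0Sn 0) ltr01 Blim Dlim.
exists N => //; exists B'; split=> //; first exact: strings.
by move=> x ox cx; case: nox; exists x.
Qed.

(** Step j of the construction treats the j-th rational target.  The matrices obtained live at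
    increasing levels m j and are block sums of one another, so each determines
    all the coarser levels consistently. *)
Lemma limit_tree : exists a : seq bool -> seq bool -> R,
  [/\ forall m, limit_string_shape m a,
      forall N s t, size s = size t -> a s t = block_sum N a s t &
      forall k (D : 'I_k -> 'I_k -> R) e, (0 < k)%N -> limit_shape D -> 0 < e ->
        exists m, exists2 F : 'I_k -> m.-tuple bool -> R, balanced F &
          forall i j, `|coarsen (fun s t : m.-tuple bool => a s t) F i j - D i j| <= e].
Proof.
pose X := (nat * {x : nat * (seq bool -> seq bool -> R) | limit_string_shape x.1 x.2})%type.
pose lev (x : X) := (sval x.2).1; pose mat (x : X) := (sval x.2).2.
pose next (x y : X) : Prop := [/\ y.1 = x.1.+1,
  exists N, [/\ (0 < N)%N, lev y = (lev x + N)%N &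
    forall s t, size s = lev x -> size t = lev x -> mat x s t = block_sum N (mat y) s t] &
  forall z, unpickle x.1 = Some z -> capturable z -> captures (lev y) (mat y) z].
have next_ex x : {y | next x y}.
  apply: cid; case: x => j [[m B] /= Blim].
  have [N N0 [B' [B'lim BB' capt]]] := refine_capture (unpickle j) Blim.
  exists (j.+1, exist _ ((m + N)%N, B') B'lim); split=> //.
  by exists N.
have [|B0 B0lim] := @limit_shape_exists (0.-tuple bool).
  by rewrite card_tuple.
have B0lim' : limit_string_shape 0 (fun _ _ => B0 [tuple] [tuple]).
  rewrite /limit_string_shape; suff -> : (fun _ _ : 0.-tuple bool => B0 [tuple] [tuple]) = B0 by [].
  by apply/funext => u; apply/funext => v; rewrite [u]tuple0 [v]tuple0.
have [f [f0 fnext]] := dependent_choice next_ex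
  (0%N, exist (fun x => limit_string_shape x.1 x.2) (0%N, _) B0lim').
have f1 j : (f j).1 = j by elim: j => [|j IH]; [rewrite f0|have [-> _ _] := fnext j; rewrite IH].
pose m j := lev (f j); pose B j := mat (f j).
have Blim j : limit_string_shape (m j) (B j) by rewrite /m /B /lev /mat; case: (f j).2.
have mB j : exists N, [/\ (0 < N)%N, m j.+1 = (m j + N)%N &
    forall s t, size s = m j -> size t = m j -> B j s t = block_sum N (B j.+1) s t].
  by have [_ ? _] := fnext j.
have m_ge j : (j <= m j)%N.
  by elim: j => // j IH; have [N [N0 -> _]] := mB j; lia.
have m_mono j l : (m j <= m (j + l))%N.
  elim: l => [|l IH]; first by rewrite addn0.
  by rewrite addnS; have [N [N0 -> _]] := mB (j + l)%N; lia.
have step j l s t p : size s = p -> size t = p -> (p <= m j)%N ->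
    block_sum (m j - p) (B j) s t = block_sum (m (j + l)%N - p) (B (j + l)%N) s t.
  move=> sp tp pm; elim: l => [|l ->]; first by rewrite addn0.
  rewrite addnS; have [N [N0 mN BN]] := mB (j + l)%N.
  have pml : (p <= m (j + l))%N by exact: leq_trans (m_mono j l).
  have -> : (m (j + l).+1 - p = (m (j + l) - p) + N)%N by lia.
  rewrite block_sumD; apply: eq_block_sum => u v.
  by apply: BN; rewrite size_cat size_tuple ?sp ?tp; lia.
(* any matrix of a level at least size s would do; number size s is deep enough *)
pose a s t := block_sum (m (size s) - size s) (B (size s)) s t.
have aE j s t : size s = size t -> (size s <= m j)%N ->
    a s t = block_sum (m j - size s) (B j) s t.
  move=> /esym ts sm; rewrite /a; have [sj|/ltnW js] := leqP (size s) j.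
    by have := step (size s) (j - size s)%N s t _ erefl ts (m_ge _); rewrite subnKC.
  by have := step j (size s - j)%N s t _ erefl ts sm; rewrite subnKC// => ->.
have aB j s t : size s = m j -> size t = m j -> a s t = B j s t.
  by move=> sm tm; rewrite (aE j) ?sm ?tm ?leqnn// subnn block_sum0.
exists a; split.
- move=> p; have := Blim p; rewrite -(subnKC (m_ge p)) => /limit_string_shape_block.
  congr limit_shape; apply/funext => u; apply/funext => v.
  by rewrite (aE p) ?size_tuple.
- move=> N s t st; pose j := (size s + N)%N.
  have jm : (size s + N <= m j)%N by exact: m_ge.
  rewrite (aE j) ?(leq_trans _ jm) ?leq_addr//.
  have -> : (m j - size s = N + (m j - (size s + N)))%N by lia.
  rewrite block_sumD; apply: eq_block_sum => p q.
  by rewrite (aE j) ?size_cat ?size_tuple ?st// -st.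
- move=> k D e k0 Dlim e0; pose l := Num.truncn (3 / e).
  have le : 3 / l.+1%:R <= e.
    rewrite ler_pdivrMr// mulrC -ler_pdivrMr// ltW//.
    by have /truncn_itv/andP[] : 0 <= 3 / e by rewrite divr_ge0// ltW.
  have l0 : 0 < l.+1%:R^-1 :> R by rewrite invr_gt0.
  have /choice[q qP] : forall p : 'I_k * 'I_k, exists q : rat, `|D p.1 p.2 - ratr q| <= l.+1%:R^-1.
    move=> p; have [|q] := @rat_in_itvoo R (D p.1 p.2 - l.+1%:R^-1) (D p.1 p.2 + l.+1%:R^-1).
      by rewrite ltrBlDr -addrA ltrDl addr_gt0.
    rewrite in_itv/= => /andP[q1 q2]; exists q; apply: ltW.
    by rewrite distrC ltr_distl q1.
  pose z : rat_target := (Tagged (fun k => {ffun 'I_k * 'I_k -> rat}) [ffun p => q p], l).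
  have zc : capturable z.
    by exists D; split=> // i j /=; rewrite ffunE; exact: (qP (i, j)).
  have [_ _ capt] := fnext (pickle z).
  have [|F bF FD] := capt z _ zc; first by rewrite f1 pickleK.
  exists (m (pickle z).+1), F => // i j.
  have -> : (fun s t : (m (pickle z).+1).-tuple bool => a s t) =
      (fun s t : (m (pickle z).+1).-tuple bool => B (pickle z).+1 s t).
    by apply/funext => s; apply/funext => t; rewrite (aB (pickle z).+1) ?size_tuple.
  have := FD i j; rewrite /= ffunE; have := qP (i, j) => /=.
  set x := coarsen _ _ _ _; rewrite -/(B (pickle z).+1) => qD xq; apply: le_trans le.
  have -> : 3 / l.+1%:R = 2 / l.+1%:R + l.+1%:R^-1 :> R by ring.
  rewrite [X in `|X|](_ : _ = (x - ratr (q (i, j))) - (D i j - ratr (q (i, j)))); last by ring.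
  by apply: le_trans (ler_normB _ _) _; rewrite lerD.
Qed.

End limit_shapes.

(** * Cylinders in Cantor space *)

Section cylinders.

(** Otherwise some sequence of points outside U, agreeing with x on longer and longer
    prefixes, would converge to x. *)
Lemma nbhs_cylinder (x : cantor_space) (U : set cantor_space) : nbhs x U ->
  exists m, forall y : cantor_space, mkseq y m = mkseq x m -> U y.
Proof.
move=> Ux; apply: contrapT => /forallNP nU.
have /choice[y yP] : forall m, exists y : cantor_space, mkseq y m = mkseq x m /\ ~ U y.
  by move=> m; have /existsNP[y /not_implyP] := nU m; exists y.
have /(_ U Ux) : (y : nat -> cantor_space) @ \oo --> x.
  apply/cvg_sup => i; apply/cvg_image.
    by apply/seteqP; split => // b _; exists (fun=> b).
  move=> V Vx; exists [set z | V (z i)] => //; last first.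
    by apply/seteqP; split => [b [z zV <-]//|b Vb]; exists (fun=> b).
  exists i.+1 => // m /= ltim; have := congr1 (nth false ^~ i) (yP m).1.
  by rewrite /= !nth_mkseq// => ->; exact: nbhs_singleton.
by move=> [N _ /(_ N (leqnn N))]; exact: (yP N).2.
Qed.

Definition cylinder m (s : seq bool) : set (borel cantor_space) := [set x | mkseq x m = s].

Definition box m (s t : seq bool) : set (borel (cantor_space * cantor_space)%type) :=
  [set p | mkseq p.1 m = s /\ mkseq p.2 m = t].

Lemma mkseq_take m l (x : nat -> bool) : (m <= l)%N -> mkseq x m = take m (mkseq x l).
Proof. by move=> ml; rewrite /mkseq -map_take take_iota (minn_idPl ml). Qed.

Lemma nbhs_box (p : cantor_space * cantor_space) (U : set (cantor_space * cantor_space)) :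
  nbhs p U -> exists m, box m (mkseq p.1 m) (mkseq p.2 m) `<=` U.
Proof.
move=> [[A B] [/= /nbhs_cylinder[m mA] /nbhs_cylinder[l lB]] ABU].
exists (maxn m l) => q [q1 q2]; apply: ABU; split=> /=.
  apply: mA; rewrite !(@mkseq_take m (maxn m l)) ?leq_maxl//.
  by congr take; exact: q1.
apply: lB; rewrite !(@mkseq_take l (maxn m l)) ?leq_maxr//.
by congr take; exact: q2.
Qed.

Context {d : measure_display} {T : measurableType d}.

Lemma measurable_mkseq (f : nat -> T -> bool) :
  (forall i b, measurable [set t | f i t = b]) ->
  forall m s, measurable [set t | mkseq (f^~ t) m = s].
Proof.
move=> mf; elim=> [|m IH] s.
  by case: s => [|b s]; [rewrite (_ : mkset _ = setT)|rewrite (_ : mkset _ = set0)];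
    rewrite ?measurable0//; apply/seteqP; split.
case/lastP: s => [|s b].
  by rewrite (_ : mkset _ = set0)//; apply/seteqP; split.
rewrite (_ : mkset _ = [set t | mkseq (f^~ t) m = s] `&` [set t | f m t = b]).
  exact: measurableI.
apply/seteqP; split=> t; rewrite /setI /mkset mkseqS; first by move/rcons_inj => [].
by move=> [-> ->].
Qed.

Lemma measurable_fun_square (f : T -> borel (cantor_space * cantor_space)%type) :
  (forall i b, measurable [set t | (f t).1 i = b]) ->
  (forall i b, measurable [set t | (f t).2 i = b]) ->
  measurable_fun setT f.
Proof.
move=> mf1 mf2.
have mbox m s t : measurable (f @^-1` box m s t).
  by apply: measurableI; exact: measurable_mkseq.
apply: (@measurability _ _ _ _ setT f (@open (cantor_space * cantor_space)%type)) => //.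
move=> _ [U oU <-]; rewrite setTI.
pose F (i : nat * (seq bool * seq bool)) : set T :=
  if `[< box i.1 i.2.1 i.2.2 `<=` U >] then f @^-1` box i.1 i.2.1 i.2.2 else set0.
rewrite (_ : f @^-1` U = \bigcup_i F i).
  apply: countable_bigcupT_measurable => [|i]; first exact: countableP.
  by rewrite /F; case: ifP.
apply/seteqP; split=> t /=.
  move=> Ut; have [m mU] := nbhs_box (open_nbhs_nbhs (conj oU Ut)).
  exists (m, (mkseq (f t).1 m, mkseq (f t).2 m)) => //.
  by rewrite /F/= asboolT.
by move=> [i _]; rewrite /F; case: asboolP => // sU; exact: sU.
Qed.

End cylinders.

Section measurable_cylinders.

Lemma measurable_coord (i : nat) b : measurable [set x : borel cantor_space | x i = b].
Proof.
apply: sub_sigma_algebra.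
have /continuousP pc : continuous (fun x : cantor_space => x i).
  exact: (@proj_continuous nat (fun=> bool) i).
by apply: (pc [set c | c = b]); exact: discrete_open.
Qed.

Lemma measurable_cylinder m s : measurable (cylinder m s).
Proof.
exact: (measurable_mkseq (f := fun i (x : borel cantor_space) => x i) measurable_coord).
Qed.

Lemma measurable_fun_generators (X Y : pointedType) (G : set (set X)) (H : set (set Y))
  (f : X -> Y) : (forall A, H A -> G (f @^-1` A)) ->
  measurable_fun setT (f : g_sigma_algebraType G -> g_sigma_algebraType H).
Proof.
move=> GH; apply: (@measurability _ _ (g_sigma_algebraType G) (g_sigma_algebraType H) setT f H)
  => //.
by move=> _ [A HA <-]; rewrite setTI; apply: sub_sigma_algebra; exact: GH.
Qed.

Lemma measurable_borel_fst : measurable_fun setT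
  (fst : borel (cantor_space * cantor_space)%type -> borel cantor_space).
Proof.
apply: measurable_fun_generators => A oA.
have /continuousP c : continuous (@fst cantor_space cantor_space) by move=> p; exact: cvg_fst.
exact: c.
Qed.

Lemma measurable_borel_snd : measurable_fun setT
  (snd : borel (cantor_space * cantor_space)%type -> borel cantor_space).
Proof.
apply: measurable_fun_generators => A oA.
have /continuousP c : continuous (@snd cantor_space cantor_space) by move=> p; exact: cvg_snd.
exact: c.
Qed.

Lemma measurable_box m s t : measurable (box m s t).
Proof.
have := measurable_borel_fst measurableT (measurable_cylinder m s).
have := measurable_borel_snd measurableT (measurable_cylinder m t).
rewrite !setTI => mt ms; exact: (measurableI _ _ ms mt).
Qed.

End measurable_cylinders.

(** * From trees to measures *)

Lemma exists_image_measure d d' (T1 : measurableType d) (T2 : measurableType d') (R : realType)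
  (m : {measure set T1 -> \bar R}) (f : T1 -> T2) : measurable_fun setT f ->
  exists m' : {measure set T2 -> \bar R}, forall A, m' A = m (f @^-1` A).
Proof. by move=> mf; unshelve eexists (pushforward m f : {measure set T2 -> \bar R}). Qed.

Lemma exists_finite_restriction d (T : measurableType d) (R : realType)
  (m : {measure set T -> \bar R}) (D : set T) : measurable D -> (m D < +oo)%E ->
  exists m' : {finite_measure set T -> \bar R}, forall A, m' A = m (A `&` D).
Proof. by move=> mD moo; exists (mfrestr mD moo). Qed.

(** Weights on the binary tree that are additive under branching cut the interval
    [0, w []) into nested subintervals of lengths w u; the branch followed by a point x
    has Lebesgue distribution w. *)
Section binary_tree.
Context (R : realType) (w : seq bool -> R).
Hypothesis w_ge0 : forall u, 0 <= w u.
Hypothesis w_split : forall u, w u = w (rcons u false) + w (rcons u true).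

(** The left endpoint of the interval attached to u. *)
Let off (u : seq bool) : R :=
  \sum_(i < size u) if nth false u i then w (rcons (take i u) false) else 0.

Let off_rcons u b : off (rcons u b) = off u + if b then w (rcons u false) else 0.
Proof.
rewrite /off size_rcons big_ord_recr/= nth_rcons ltnn eqxx; congr (_ + _).
  apply: eq_bigr => i _; rewrite nth_rcons ltn_ord -[rcons u b]cats1 takel_cat//.
  exact: ltnW.
by rewrite -[rcons u b]cats1 take_size_cat.
Qed.

Let mid u : R := off u + w (rcons u false).

(** For x in [0, w []), the string of length n whose interval contains x. *)
Let path x := fix path n := if n is m.+1 then rcons (path m) (mid (path m) <= x) else [::].

Definition digit (i : nat) (x : R) : bool := mid (path x i) <= x.

Let digit_path x m : mkseq (digit^~ x) m = path x m.
Proof. by elim: m => // m IH; rewrite mkseqS IH. Qed.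

Lemma measurable_digit i b : measurable [set x : R | digit i x = b].
Proof.
have mmid s c : measurable [set x : R | (mid s <= x) = c].
  case: c.
    rewrite (_ : mkset _ = `[mid s, +oo[%classic) ?measurable_itv//.
    by apply/seteqP; split=> x /=; rewrite in_itv/= andbT.
  rewrite (_ : mkset _ = `]-oo, mid s[%classic) ?measurable_itv//.
  by apply/seteqP; split=> x /=; rewrite in_itv/= ltNge; [move=> ->|move/negbTE].
have mpath m : forall s, measurable [set x : R | path x m = s].
  elim: m => [|m IH] s.
    by case: s => [|c s]; [rewrite (_ : mkset _ = setT)|rewrite (_ : mkset _ = set0)];
      rewrite ?measurable0//; apply/seteqP; split.
  case/lastP: s => [|s c].
    rewrite (_ : mkset _ = set0)//; apply/seteqP; split=> // x /= /(congr1 size).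
    by rewrite size_rcons.
  rewrite (_ : mkset _ = [set x | path x m = s] `&` [set x | (mid s <= x) = c]).
    exact: measurableI.
  by apply/seteqP; split=> x /=; [move/rcons_inj => [<-]|move=> [-> ->]].
rewrite (_ : mkset _ = \bigcup_s ([set x | path x i = s] `&`
    [set x | (mid s <= x) = b])).
  apply: countable_bigcupT_measurable => [|s]; first exact: countableP.
  exact: measurableI.
by apply/seteqP; split=> [x <-|x [s _ [<-]]//]; exists (path x i).
Qed.

Let pathP u x : 0 <= x < w [::] -> path x (size u) = u <-> off u <= x < off u + w u.
Proof.
move=> x01; elim/last_ind: u => [|u b IH].
  by rewrite /off big_ord0 add0r; split.
rewrite size_rcons /= off_rcons.
have w0 := w_ge0 (rcons u false); have w1 := w_ge0 (rcons u true).
split=> [/rcons_inj[pu]|].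
  rewrite pu /mid; move/IH: pu; rewrite (w_split u) => /andP[h1 h2] <-.
  by case: (leP (off u + w (rcons u false)) x) => h3; apply/andP; split; lra.
move=> h; have /IH -> : off u <= x < off u + w u.
  by move: h; rewrite (w_split u); case: (b) => /andP[h1 h2]; apply/andP; split; lra.
congr rcons; rewrite /mid.
by case: b h => /andP[h1 h2]; [apply/idP; lra|apply/negbTE; rewrite -ltNge; lra].
Qed.

Let off_bounds u : 0 <= off u /\ off u + w u <= w [::].
Proof.
elim/last_ind: u => [|u b [h1 h2]]; first by rewrite /off big_ord0 add0r.
have w0 := w_ge0 (rcons u false); have w1 := w_ge0 (rcons u true).
by move: h2; rewrite off_rcons (w_split u); case: b; lra.
Qed.

Lemma lebesgue_digit u :
  lebesgue_measure (`[0, w [::][ `&` [set x | mkseq (digit^~ x) (size u) = u]) = (w u)%:E.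
Proof.
rewrite (_ : _ `&` _ = [set` `[off u, off u + w u[]).
  rewrite lebesgue_measure_itv/= lte_fin ltrDl; have := w_ge0 u.
  rewrite le_eqVlt => /orP[/eqP <-|wu]; first by rewrite ltxx.
  by rewrite wu -EFinB addrAC subrr add0r.
apply/seteqP; split=> x /=; rewrite digit_path !in_itv/=.
  by move=> [x01 /(pathP u x01)].
move=> xu; have [h1 h2] := off_bounds u.
have x01 : 0 <= x < w [::] by case/andP: xu => h3 h4; apply/andP; split; lra.
by split=> //; apply/(pathP u x01).
Qed.

End binary_tree.

(** A tree on pairs of strings becomes a binary tree by interleaving: the bits of even
    rank of u form the first string, those of odd rank the second.  At odd
    length the second string is one bit short, and the weight sums over that bit. *)
Section square_tree.
Context (R : realType) (a : seq bool -> seq bool -> R).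
Hypothesis a_ge0 : forall s t, size s = size t -> 0 <= a s t.
Hypothesis a_split : forall s t, size s = size t ->
  a s t = \sum_b \sum_c a (rcons s b) (rcons t c).

Let ev (u : seq bool) := mkseq (fun i => nth false u i.*2) (uphalf (size u)).
Let od (u : seq bool) := mkseq (fun i => nth false u i.*2.+1) (size u)./2.

Let w (u : seq bool) : R :=
  if odd (size u) then \sum_c a (ev u) (rcons (od u) c) else a (ev u) (od u).

Let ev_rcons u b : ev (rcons u b) = if odd (size u) then ev u else rcons (ev u) b.
Proof.
rewrite /ev size_rcons; case: ifP => ou.
  rewrite (_ : uphalf _ = uphalf (size u)); last by lia.
  apply/eq_in_map => i; rewrite mem_iota add0n => /andP[_ i_lt].
  by rewrite nth_rcons ifT//; lia.
rewrite (_ : uphalf (size u).+1 = (uphalf (size u)).+1); last by lia.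
rewrite mkseqS nth_rcons ifF ?ifT; [|lia|lia]; congr rcons.
apply/eq_in_map => i; rewrite mem_iota add0n => /andP[_ i_lt].
by rewrite nth_rcons ifT//; lia.
Qed.

Let od_rcons u b : od (rcons u b) = if odd (size u) then rcons (od u) b else od u.
Proof.
rewrite /od size_rcons; case: ifP => ou; last first.
  rewrite (_ : (size u).+1./2 = (size u)./2); last by lia.
  apply/eq_in_map => i; rewrite mem_iota add0n => /andP[_ i_lt].
  by rewrite nth_rcons ifT//; lia.
rewrite (_ : (size u).+1./2 = (size u)./2.+1); last by lia.
rewrite mkseqS nth_rcons ifF ?ifT; [|lia|lia]; congr rcons.
apply/eq_in_map => i; rewrite mem_iota add0n => /andP[_ i_lt].
by rewrite nth_rcons ifT//; lia.
Qed.

Let size_ev_od u : size (ev u) = (odd (size u) + size (od u))%N.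
Proof. by rewrite !size_mkseq; lia. Qed.

Let w_ge0 u : 0 <= w u.
Proof.
rewrite /w; case: ifP => ou; last by apply: a_ge0; rewrite size_ev_od ou.
by apply: sumr_ge0 => c _; apply: a_ge0; rewrite size_ev_od ou size_rcons.
Qed.

Let w_split u : w u = w (rcons u false) + w (rcons u true).
Proof.
rewrite /w !size_rcons/= !ev_rcons !od_rcons; case: ifP => ou /=.
  by rewrite big_bool addrC.
by rewrite a_split ?big_bool 1?addrC// size_ev_od ou.
Qed.

Lemma square_tree_measure :
  exists mu : {measure set (borel (cantor_space * cantor_space)%type) -> \bar R},
    forall m s t, size s = m -> size t = m -> mu (box m s t) = (a s t)%:E.
Proof.
pose D (x : measurableTypeR R) : borel (cantor_space * cantor_space)%type :=
  (fun i => digit w i.*2 x, fun i => digit w i.*2.+1 x).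
have mD : measurable_fun setT D.
  by apply: measurable_fun_square => i b; exact: measurable_digit.
have mI : measurable (`[0, w [::][%classic : set (measurableTypeR R)) by exact: measurable_itv.
have Ioo : (lebesgue_measure (`[0%R, w [::][%classic%R : set R) < +oo)%E.
  by rewrite lebesgue_measure_itv/=; case: ifP; rewrite ?ltry.
have [Q QE] := exists_finite_restriction mI Ioo.
have [mu muE] := exists_image_measure Q mD.
exists mu => m s t sm tm; rewrite muE; apply: etrans (QE _) _.
(* the interleaving of s and t *)
pose u := mkseq (fun i => if odd i then nth false t i./2 else nth false s i./2) m.*2.
have su : size u = m.*2 by rewrite size_mkseq.
have mkE x : mkseq (digit w ^~ x) (size u) = u <->
    mkseq (fun i => digit w i.*2 x) m = s /\ mkseq (fun i => digit w i.*2.+1 x) m = t.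
  split=> [xu|[xs xt]].
    split; apply: (@eq_from_nth _ false); rewrite size_mkseq// => i im.
      have := congr1 (nth false ^~ i.*2) xu; rewrite !nth_mkseq//; [|lia|lia].
      by rewrite odd_double doubleK.
    have := congr1 (nth false ^~ i.*2.+1) xu; rewrite !nth_mkseq//; [|lia|lia].
    by rewrite /= odd_double/= uphalf_double.
  apply: (@eq_from_nth _ false); rewrite !size_mkseq// => i im.
  rewrite [in RHS]/u !nth_mkseq ?su//; have i2 : (i./2 < m)%N by lia.
  case: ifP => oi.
    by rewrite -xt nth_mkseq//; congr digit; lia.
  by rewrite -xs nth_mkseq//; congr digit; lia.
transitivity (lebesgue_measure
    (`[0, w [::][%classic `&` [set x : R | mkseq (digit w ^~ x) (size u) = u])).
  congr lebesgue_measure.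
  by apply/seteqP; split=> x [/= h xI]; split=> //; [exact/mkE|apply/mkE].
rewrite lebesgue_digit//; congr EFin; rewrite /w su odd_double; congr a.
  rewrite /ev su uphalf_double; apply: (@eq_from_nth _ false); rewrite size_mkseq// => i im.
  by rewrite !nth_mkseq//; [rewrite odd_double doubleK|lia].
rewrite /od su doubleK; apply: (@eq_from_nth _ false); rewrite size_mkseq// => i im.
by rewrite !nth_mkseq//; [rewrite /= odd_double/= uphalf_double|lia].
Qed.

End square_tree.

Section symmetric_square.
Context (R : realType) (a : seq bool -> seq bool -> R).
Hypothesis a_ge0 : forall s t, size s = size t -> 0 <= a s t.
Hypothesis a_split : forall s t, size s = size t ->
  a s t = \sum_b \sum_c a (rcons s b) (rcons t c).
Hypothesis a_sym : forall s t, size s = size t -> a s t = a t s.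

Let swap : borel (cantor_space * cantor_space)%type -> borel (cantor_space * cantor_space)%type :=
  fun p => (p.2, p.1).

Let measurable_swap : measurable_fun setT swap.
Proof.
apply: measurable_fun_generators => A oA.
have /continuousP c : continuous (@unstable.swap cantor_space cantor_space) := swap_continuous.
exact: c.
Qed.

(** Averaging the measure with its mirror image makes it symmetric without changing the
    values on boxes, as [a] is symmetric. *)
Lemma symmetric_square_measure :
  exists mu : {finite_measure set (borel (cantor_space * cantor_space)%type) -> \bar R},
    symmetric_measure mu /\
    forall m s t, size s = m -> size t = m -> mu (box m s t) = (a s t)%:E.
Proof.
have [mu1 mu1E] := square_tree_measure a_ge0 a_split.
have [mu2 mu2E] := exists_image_measure mu1 measurable_swap.
have half0 : 0 <= 2^-1 :> R by rewrite invr_ge0.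
pose mu3 : {measure set (borel (cantor_space * cantor_space)%type) -> \bar R} :=
  mscale (NngNum half0) (measure_add mu1 mu2).
have mu3E A : mu3 A = (2^-1%:E * (mu1 A + mu1 (swap @^-1` A)))%E.
  by rewrite /mu3 /mscale; congr (_ * _)%E; rewrite -mu2E; exact: measure_addE.
have mu3box m s t : size s = m -> size t = m -> mu3 (box m s t) = (a s t)%:E.
  move=> sm tm; rewrite mu3E mu1E//.
  have -> : swap @^-1` box m s t = box m t s by apply/seteqP; split=> p [].
  rewrite mu1E// (a_sym (s := t)) ?sm// -EFinD -EFinM; congr EFin; lra.
have boxT : box 0 [::] [::] = setT by apply/seteqP; split.
have [|mu muE] := exists_finite_restriction (m := mu3) (@measurableT _ _).
  by apply: le_lt_trans (ltry (a [::] [::])); rewrite -(mu3box 0%N)// boxT.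
exists mu; split=> [A mA|m s t sm tm]; last by rewrite muE setIT; exact: mu3box.
apply: etrans (muE _) (etrans _ (esym (muE _))).
rewrite !setIT; apply: etrans (mu3E _) (etrans _ (esym (mu3E _))).
rewrite addeC; congr (_ * (_ + _))%E; congr (mu1 _).
by apply/seteqP; split=> -[].
Qed.

End symmetric_square.

(** * Approximation of Borel sets by cylinders *)

Section cylinder_approximation.
Context (R : realType) (la : {measure set (borel cantor_space) -> \bar R}).
Hypothesis la_fin : (la setT < +oo)%E.

Definition string_set m (K : pred (seq bool)) : set (borel cantor_space) :=
  [set x | K (mkseq x m)].

Lemma measurable_string_set m K : measurable (string_set m K).
Proof.
rewrite (_ : string_set m K = \bigcup_s (if K s then cylinder m s else set0)).
  apply: countable_bigcupT_measurable => [|s]; first exact: countableP.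
  by case: ifP => // _; exact: measurable_cylinder.
apply/seteqP; split=> [x Kx|x [s _]]; last first.
  by case: ifP => // Ks xs; rewrite /string_set /= -(xs : mkseq x m = s) in Ks *.
by exists (mkseq x m) => //; rewrite (Kx : K (mkseq x m)).
Qed.

Lemma string_set_leq m l K : (m <= l)%N ->
  string_set m K = string_set l (fun s => K (take m s)).
Proof. by move=> ml; apply/seteqP; split=> x; rewrite /string_set/= (mkseq_take _ ml). Qed.

Let approx (A : set (borel cantor_space)) := measurable A /\
  forall e : R, 0 < e -> exists m K, (la (A `+` string_set m K) <= e%:E)%E.

Let measurable_symdiff (A B : set (borel cantor_space)) :
  measurable A -> measurable B -> measurable (A `+` B).
Proof. by move=> mA mB; apply: measurableU; exact: measurableD. Qed.

Let approx_cylinder m s : approx (cylinder m s).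
Proof.
split=> [|e e0]; first exact: measurable_cylinder.
exists m, (pred1 s); rewrite (_ : _ `+` _ = set0) ?measure0 ?lee_fin ?(ltW e0)//.
by rewrite (_ : string_set _ _ = cylinder m s) ?setYK//; apply/seteqP; split=> x /eqP.
Qed.

Let approx_setC A : approx A -> approx (~` A).
Proof.
move=> [mA Ae]; split=> [|e e0]; first exact: measurableC.
have [m [K KA]] := Ae e e0; exists m, (predC K).
rewrite (_ : _ `+` _ = A `+` string_set m K)//.
rewrite (_ : string_set m (predC K) = ~` string_set m K); last first.
  by apply/seteqP; split=> x /=; [move/negP|move/negP].
by rewrite /setY !setDE !setCK setUC [X in X `|` _]setIC [X in _ `|` X]setIC.
Qed.

Let approx_set0 : approx set0.
Proof.
rewrite -[set0]setCK setC0; apply: approx_setC.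
by rewrite (_ : setT = cylinder 0 [::]); [exact: approx_cylinder|apply/seteqP; split].
Qed.

Let approx_setU A B : approx A -> approx B -> approx (A `|` B).
Proof.
move=> [mA Ae] [mB Be]; split=> [|e e0]; first exact: measurableU.
have e20 : 0 < e / 2 by rewrite divr_gt0.
have [m [K KA]] := Ae _ e20; have [l [L LB]] := Be _ e20.
have [ml lm] := (leq_maxl m l, leq_maxr m l).
exists (maxn m l), (fun s => K (take m s) || L (take l s)).
have -> : string_set (maxn m l) (fun s => K (take m s) || L (take l s)) =
    string_set m K `|` string_set l L.
  rewrite (string_set_leq _ ml) (string_set_leq _ lm).
  by apply/seteqP; split=> x /= /orP.
apply: (@le_trans _ _ (la ((A `+` string_set m K) `|` (B `+` string_set l L)))).
  apply: le_measure; rewrite ?inE.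
  - by apply: measurable_symdiff; apply: measurableU => //; exact: measurable_string_set.
  - by apply: measurableU; apply: measurable_symdiff => //; exact: measurable_string_set.
  - move=> x [[[Ax|Bx] /not_orP[nK nL]]|[[Kx|Lx] /not_orP[nA nB]]].
    + by left; left.
    + by right; left.
    + by left; right.
    + by right; right.
apply: le_trans (measureU2 _ _ _) _.
- by apply: measurable_symdiff => //; exact: measurable_string_set.
- by apply: measurable_symdiff => //; exact: measurable_string_set.
by rewrite [e]splitr EFinD; exact: leeD.
Qed.

Let approx_bigcup (F : (set (borel cantor_space))^nat) :
  (forall i, approx (F i)) -> approx (\bigcup_i F i).
Proof.
move=> aF; have mF i : measurable (F i) by case: (aF i).
have mUF : measurable (\bigcup_i F i) by exact: bigcupT_measurable.
split=> // e e0; have e20 : 0 < e / 2 by rewrite divr_gt0.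
pose U N := \big[setU/set0]_(i < N) F i.
have aU N : approx (U N).
  rewrite /U; elim: N => [|N IH]; last by rewrite big_ord_recr/=; exact: approx_setU.
  by rewrite big_ord0; exact: approx_set0.
have mU N : measurable (U N) by case: (aU N).
(* a finite union U N already has nearly full measure in the whole union *)
pose G N := \bigcup_i F i `\` U N.
have mG N : measurable (G N) by exact: measurableD.
have capG : \bigcap_N G N = set0.
  apply/seteqP; split=> // x xG; have [[i _ Fix] _] := xG 0%N Logic.I.
  have [_] := xG i.+1 Logic.I; apply.
  by rewrite /U big_ord_recr/=; right.
have Gcvg : la (G N) @[N --> \oo] --> (0 : \bar R)%E.
  rewrite -(measure0 la) -capG; apply: nonincreasing_cvg_mu => //.
  - by apply: le_lt_trans la_fin; apply: le_measure; rewrite ?inE//.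
  - by rewrite capG.
  - move=> N M NM; apply/subsetPset => x [Fx nU]; split=> // Ux; apply: nU.
    move: Ux; rewrite /U -!bigcup_mkord => -[i /= iN Fix]; exists i => //=.
    exact: leq_trans NM.
have [N /(_ N (leqnn N)) GN] := ereal_cvg0_lt Gcvg e20.
have [_ /(_ _ e20)[m [K UK]]] := aU N; exists m, K.
apply: (@le_trans _ _ (la (G N `|` (U N `+` string_set m K)))).
  apply: le_measure; rewrite ?inE.
  - by apply: measurable_symdiff => //; exact: measurable_string_set.
  - by apply: measurableU => //; apply: measurable_symdiff => //; exact: measurable_string_set.
  - move=> x [[Fx nK]|[Kx nF]].
      by have [Ux|nUx] := pselect (U N x); [right; left|left].
    right; right; split=> // Ux; apply: nF; move: Ux.
    by rewrite /U -bigcup_mkord => -[i _ Fix]; exists i.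
apply: le_trans (measureU2 _ _ _) _ => //.
  by apply: measurable_symdiff => //; exact: measurable_string_set.
by rewrite [e]splitr EFinD; apply: leeD => //; exact: ltW.
Qed.

(** The approximable sets form a sigma-algebra, by continuity of a finite measure along
    decreasing sequences, and open sets are countable unions of cylinders. *)
Lemma cylinder_approximation (A : set (borel cantor_space)) (e : R) :
  measurable A -> 0 < e -> exists m K, (la (A `+` string_set m K) <= e%:E)%E.
Proof.
move=> mA e0; suff [_ ApA] : approx A by exact: ApA.
move: A mA; apply: smallest_sub.
  split; first exact: approx_set0.
  - by move=> A aA; rewrite setTD; exact: approx_setC.
  - by move=> F aF; exact: approx_bigcup.
move=> U oU; pose F i := if @unpickle (nat * seq bool)%type i is Some p then
  if `[< cylinder p.1 p.2 `<=` U >] then cylinder p.1 p.2 else set0 else set0.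
have -> : U = \bigcup_i F i.
  apply/seteqP; split=> [x Ux|x [i _]]; last first.
    by rewrite /F; case: unpickle => // p; case: asboolP => // pU; exact: pU.
  have [m mU] := nbhs_cylinder (open_nbhs_nbhs (conj oU Ux)).
  by exists (pickle (m, mkseq x m)) => //; rewrite /F pickleK/= asboolT.
apply: approx_bigcup => i; rewrite /F; case: unpickle => [p|]; last exact: approx_set0.
by case: ifP => _; [exact: approx_cylinder|exact: approx_set0].
Qed.

End cylinder_approximation.

(** * Integrals of step functions *)

Section integrals.
Context d (T : measurableType d) (R : realType) (mu : {measure set T -> \bar R}).

Lemma measure_bigsetU_le (J : Type) (s : seq J) (A : J -> set T) :
  (forall j, measurable (A j)) ->
  (mu (\big[setU/set0]_(j <- s) A j) <= \sum_(j <- s) mu (A j))%E.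
Proof.
move=> mA; elim: s => [|j s IH]; first by rewrite !big_nil measure0.
rewrite !big_cons; apply: le_trans (measureU2 _ _ _) _ => //; last exact: leeD.
by apply: bigsetU_measurable.
Qed.

Let sum_fibres (J : finType) (f : T -> J) (c : J -> R) x :
  c (f x) = \sum_j c j * \1_(f @^-1` [set j]) x.
Proof.
rewrite (bigD1 (f x))//= big1 ?addr0; last first.
  by move=> j /eqP jf; rewrite indicE memNset ?mulr0// => /= fx; apply: jf.
by rewrite indicE mem_set ?mulr1.
Qed.

Lemma measurable_finite_values (J : finType) (f : T -> J) (c : J -> R) :
  (forall j, measurable (f @^-1` [set j])) -> measurable_fun setT (fun x => c (f x)).
Proof.
move=> mf; under eq_fun do rewrite sum_fibres.
apply: measurable_sum => j; apply: measurable_funM; first exact: measurable_cst.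
exact: measurable_indic.
Qed.

Lemma integral_finite_values (J : finType) (f : T -> J) (c : J -> R) :
  (forall j, measurable (f @^-1` [set j])) -> (forall j, 0 <= c j) ->
  (\int[mu]_x (c (f x))%:E = \sum_j (c j)%:E * mu (f @^-1` [set j]))%E.
Proof.
move=> mf c0; under eq_integral do rewrite sum_fibres -sumEFin.
rewrite ge0_integral_sum//; last 2 first.
- move=> j; apply/measurable_EFinP; apply: measurable_funM; first exact: measurable_cst.
  exact: measurable_indic.
- by move=> j x _; rewrite lee_fin mulr_ge0.
apply: eq_bigr => j _; rewrite (integralZl_indic measurableT (fun=> f @^-1` [set j]))//.
  by rewrite integral_indic// setIT.
by move=> cj; have := c0 j; rewrite leNgt cj.
Qed.

(** Off N the integrands differ by at most e, on N by at most 1. *)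
Lemma integral_close (f g : T -> R) (N : set T) (e M t u v : R) :
  measurable_fun setT f -> measurable_fun setT g -> measurable N -> 0 <= e ->
  (forall x, 0 <= f x <= 1) -> (forall x, 0 <= g x <= 1) ->
  (forall x, ~ N x -> `|f x - g x| <= e) ->
  (mu setT <= M%:E)%E -> (mu N <= t%:E)%E ->
  (\int[mu]_x (f x)%:E = u%:E)%E -> (\int[mu]_x (g x)%:E = v%:E)%E ->
  `|u - v| <= e * M + t.
Proof.
move=> mf mg mN e0 f01 g01 fg muM muN fu gv.
have half (h k : T -> R) p q : measurable_fun setT h -> measurable_fun setT k ->
    (forall x, 0 <= h x <= 1) -> (forall x, 0 <= k x <= 1) ->
    (forall x, ~ N x -> `|h x - k x| <= e) ->
    (\int[mu]_x (h x)%:E = p%:E)%E -> (\int[mu]_x (k x)%:E = q%:E)%E -> p <= q + (e * M + t).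
  move=> mh mk h01 k01 hk hp kq.
  rewrite -lee_fin -hp !EFinD -kq.
  have mE (h' : T -> R) : measurable_fun setT h' -> measurable_fun setT (fun x => (h' x)%:E).
    by move=> mh'; apply/measurable_EFinP.
  apply: (@le_trans _ _ (\int[mu]_x ((k x)%:E + (e%:E + (\1_N x)%:E)))%E).
    apply: ge0_le_integral => //.
    - by move=> x _; rewrite lee_fin; case/andP: (h01 x).
    - exact: mE.
    - apply: emeasurable_funD; first exact: mE.
      apply: emeasurable_funD; first exact: measurable_cst.
      by apply: mE; exact: measurable_indic.
    - move=> x _; rewrite -!EFinD lee_fin.
      have /andP[h0 h1] := h01 x; have /andP[k0 k1] := k01 x.
      have [Nx|nNx] := pselect (N x); first by rewrite indicE mem_set//=; lra.
      have := hk x nNx; rewrite ler_norml indicE memNset//= => /andP[_]; lra.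
  rewrite ge0_integralD//; last 4 first.
  - by move=> x _; rewrite lee_fin; case/andP: (k01 x).
  - exact: mE.
  - by move=> x _; rewrite -EFinD lee_fin addr_ge0.
  - apply: emeasurable_funD; first exact: measurable_cst.
    by apply: mE; exact: measurable_indic.
  rewrite leeD2l// ge0_integralD//; last by apply: mE; exact: measurable_indic.
  rewrite integral_indic// setIT; apply: leeD => //.
  by rewrite (integral_cst mu measurableT e%:E) EFinM lee_wpmul2l.
have := half f g u v mf mg f01 g01 fg fu gv.
have gf x : ~ N x -> `|g x - f x| <= e by move=> nN; rewrite distrC fg.
have := half g f v u mg mf g01 f01 gf gv fu.
by move=> vu uv; rewrite ler_norml; apply/andP; split; lra.
Qed.

End integrals.

Section steps.
Variable R : realType.

Definition string_of m (x : nat -> bool) : m.-tuple bool := [tuple of mkseq x m].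

Lemma string_of_cylinder m (s : m.-tuple bool) :
  [set x : borel cantor_space | string_of m x = s] = cylinder m s.
Proof. by apply/seteqP; split=> x; [move/(congr1 val)|move=> xs; apply: val_inj]. Qed.

Lemma fair_coin_cylinder m (s : m.-tuple bool) :
  fair_coin R (cylinder m s) = (2 ^- m)%:E.
Proof.
have := @fair_coinP R m (fun i => [set nth false s i]%SET).
under eq_bigr do rewrite cards1 div1r.
rewrite prodr_const card_ord exprVn => <-; congr (fair_coin R _).
apply/seteqP; split=> x /=.
  by move=> xs i im; rewrite inE -xs nth_mkseq.
move=> xs; apply: (@eq_from_nth _ false); rewrite size_mkseq ?size_tuple// => i im.
by rewrite nth_mkseq//; have := xs i im; rewrite inE => /eqP.
Qed.

Lemma measurable_string_of m (j : m.-tuple bool) :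
  measurable ((fun x : borel cantor_space => string_of m x) @^-1` [set j]).
Proof. by rewrite [X in measurable X]string_of_cylinder; exact: measurable_cylinder. Qed.

Lemma fair_coin_step m (F : m.-tuple bool -> R) : (forall s, 0 <= F s) ->
  (\int[fair_coin R]_x (F (string_of m x))%:E = ((\sum_s F s) / 2 ^+ m)%:E)%E.
Proof.
move=> F0; rewrite (integral_finite_values _ (@measurable_string_of m))//.
rewrite mulr_suml -sumEFin; apply: eq_bigr => s _; rewrite EFinM; congr (_ * _)%E.
by rewrite -(fair_coin_cylinder s) -string_of_cylinder.
Qed.

Context (a : seq bool -> seq bool -> R)
  (mu : {measure set (borel (cantor_space * cantor_space)%type) -> \bar R}).
Hypothesis mu_box : forall m s t, size s = m -> size t = m -> mu (box m s t) = (a s t)%:E.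

(** The bridge between both notions of shape: step functions on mu give coarsenings of
    the tree. *)
Lemma square_step k m (F : 'I_k -> m.-tuple bool -> R) i j : (forall l s, 0 <= F l s) ->
  (\int[mu]_p (F i (string_of m p.1) * F j (string_of m p.2))%:E =
    (coarsen (fun s t : m.-tuple bool => a s t) F i j)%:E)%E.
Proof.
move=> F0.
pose f (p : borel (cantor_space * cantor_space)%type) := (string_of m p.1, string_of m p.2).
have fE q : f @^-1` [set q] = box m q.1 q.2.
  case: q => s t; apply/seteqP; split=> p /= [].
    by move=> /(congr1 val)/= ? /(congr1 val).
  by move=> ps pt; congr pair; exact: val_inj.
rewrite (integral_finite_values mu (f := f) (c := fun q => F i q.1 * F j q.2)).
- rewrite /coarsen pair_big/= -sumEFin; apply: eq_bigr => -[s t] _ /=.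
  by rewrite fE mu_box ?size_tuple// -EFinM mulrAC.
- by move=> q; rewrite fE; exact: measurable_box.
- by move=> q; rewrite mulr_ge0.
Qed.

Lemma fractional_step k m (F : 'I_k -> m.-tuple bool -> R) : (0 < k)%N -> balanced F ->
  fractional_partition (fun l (x : borel cantor_space) => F l (string_of m x)).
Proof.
move=> k0 [F0 F1 F2]; split=> [l|l x|x|l].
- by apply: measurable_finite_values; exact: measurable_string_of.
- exact: F0.
- exact: F2.
- rewrite fair_coin_step// F1 card_tuple card_bool card_ord natrX mulrAC divff ?div1r//.
Qed.

End steps.

(** * The two descriptions of the shapes agree *)

(** Round the values of the partition to a finite net of the simplex.  The set where
    a given net point is admissible is Borel, hence close to a clopen set, for the
    sum of the coin measure and the two marginals of mu: the coin measure
    controls the averages, and the marginals control the integral even where they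
    are singular.  The resulting step function is a partition, uniformly close to f
    off a set of small measure, and [rebalance] repairs its averages. *)
Lemma step_approximation (R : realType) (a : seq bool -> seq bool -> R)
  (mu : {finite_measure set (borel (cantor_space * cantor_space)%type) -> \bar R})
  k (f : 'I_k -> borel cantor_space -> R) (z : 'I_k -> 'I_k -> R) (e : R) :
  (forall m s t, size s = m -> size t = m -> mu (box m s t) = (a s t)%:E) ->
  (0 < k)%N -> 0 < e -> fractional_partition f ->
  (forall i j, ((z i j)%:E = \int[mu]_p (f i p.1 * f j p.2)%:E)%E) ->
  exists m, exists2 F : 'I_k -> m.-tuple bool -> R, balanced F &
    forall i j, `|coarsen (fun s t : m.-tuple bool => a s t) F i j - z i j| <= e.
Proof.
move=> mu_box k0 e0 [mf f0 f1 fk] zE.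
have k0' : 1 <= k%:R :> R by rewrite ler1n.
have f01 l x : 0 <= f l x <= 1.
  by rewrite f0/= -(f1 x) (bigD1 l)//= lerDl; apply: sumr_ge0.
have muT : (mu setT)%E = (fine (mu setT))%:E by rewrite fineK// fin_num_measure.
set M := fine (mu setT) in muT.
have M0 : 0 <= M by apply: fine_ge0.
(* with an error h at each stage, the step functions end up at distance
   h + k (h + h) from f off the exceptional set, and the integrals at distance h X *)
pose X := 2 * (1 + 2 * k%:R) * M + 2.
have X0 : 0 < X by rewrite ltr_wpDl// !mulr_ge0//; lra.
pose h := Num.min (2 * k%:R)^-1 (e / X).
have h0 : 0 < h by rewrite /h lt_min divr_gt0// invr_gt0 mulr_gt0//; lra.
have hk : k%:R * (h + h) <= 1.
  have : h * (2 * k%:R) <= 1 by rewrite -ler_pdivlMr ?mulr_gt0 ?div1r ?ge_min ?lexx//; lra.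
  by lra.
have hX : h * X <= e by rewrite -ler_pdivlMr// ge_min lexx orbT.
have [C [rep [repS repP]]] := simplex_net k0 h0.
have /card_gt0P[g0 _] : (0 < #|C|)%N.
  have [|g _] := repP (f^~ point); first by split.
  by apply/card_gt0P; exists g.
pose B g : set (borel cantor_space) := [set x | forall l, `|rep g l - f l x| <= h].
have mB g : measurable (B g).
  rewrite (_ : B g = \bigcap_(l in [set: 'I_k]) [set x | `|rep g l - f l x| <= h]).
    apply: fin_bigcap_measurable => // l _.
    rewrite -[X in measurable X]setTI; apply: measurable_fun_le => //.
    apply: measurableT_comp => //; apply: measurable_funB => //.
  by apply/seteqP; split=> x Bx l; [move=> _|]; exact: Bx.
have [mu1 mu1E] := exists_image_measure mu measurable_borel_fst.
have [mu2 mu2E] := exists_image_measure mu measurable_borel_snd.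
pose la : {measure set (borel cantor_space) -> \bar R} :=
  measure_add (fair_coin R) (measure_add mu1 mu2).
have laE A : la A = (fair_coin R A + (mu (fst @^-1` A) + mu (snd @^-1` A)))%E.
  apply: etrans (measure_addE _ _ _) _; congr (_ + _)%E.
  apply: etrans (measure_addE _ _ _) _; congr (_ + _)%E.
    exact: mu1E.
  exact: mu2E.
have la_fin : (la setT < +oo)%E.
  by rewrite laE probability_setT !preimage_setT muT -!EFinD ltry.
pose D := h / (#|C|%:R + 1).
have D0 : 0 < D by rewrite divr_gt0// ltr_wpDl.
have /choice[mm /choice[KK KKP]] : forall g, exists m K, (la (B g `+` string_set m K) <= D%:E)%E.
  by move=> g; exact: cylinder_approximation.
pose m := \max_g mm g; pose K g s := KK g (take (mm g) s).
have KP g : (la (B g `+` string_set m (K g)) <= D%:E)%E.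
  by rewrite -string_set_leq ?KKP//; exact: leq_bigmax.
pose N := \big[setU/set0]_g (B g `+` string_set m (K g)).
have mN1 g : measurable (B g `+` string_set m (K g)).
  by apply: measurableU; apply: measurableD => //; exact: measurable_string_set.
have mN : measurable N by exact: bigsetU_measurable.
have laN : (la N <= h%:E)%E.
  apply: le_trans (measure_bigsetU_le _ _ mN1) _.
  apply: (@le_trans _ _ (\sum_(g : C) D%:E)%E); first by apply: lee_sum => g _; exact: KP.
  rewrite sumEFin lee_fin sumr_const -[D *+ _]mulr_natl /D mulrCA ler_piMr ?(ltW h0)//.
  by rewrite ler_pdivrMr ?mul1r ?lerDl// ltr_wpDl.
(* off N, every net point picked by a clopen set is admissible at x *)
pose c (s : seq bool) : C := if [pick g | K g s] is Some g then g else g0.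
pose G l (s : m.-tuple bool) : R := rep (c s) l.
have GfN x : ~ N x -> forall l, `|G l (string_of m x) - f l x| <= h.
  move=> nN; have nNg g : ~ (B g `+` string_set m (K g)) x.
    by move=> Ng; apply: nN; rewrite /N (bigD1 g)//=; left.
  have [|g gB] := repP (f^~ x); first by split.
  have Kg : K g (mkseq x m).
    by apply: contrapT => nK; apply: (nNg g); left.
  rewrite /G /c /=; case: pickP => [g' Kg'|/(_ g)]; last by rewrite Kg.
  suff : B g' x by [].
  by apply: contrapT => nB; apply: (nNg g'); right.
have G0 l s : 0 <= G l s by exact: (repS _).1.
have G1 s : \sum_l G l s = 1 by exact: (repS _).2.
have G01 l s : 0 <= G l s <= 1.
  by rewrite G0/= -(G1 s) (bigD1 l)//= lerDl; apply: sumr_ge0.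
have mstep (H : m.-tuple bool -> R) :
    measurable_fun setT (fun x : borel cantor_space => H (string_of m x)).
  by apply: measurable_finite_values; exact: measurable_string_of.
have two0 : 0 < 2 ^+ m :> R by rewrite exprn_gt0.
have Gsum l : `|\sum_s G l s - 2 ^+ m / k%:R| <= (h + h) * 2 ^+ m.
  have nuT : (fair_coin R setT <= 1%:E)%E by rewrite probability_setT.
  have nuN : (fair_coin R N <= h%:E)%E.
    by apply: le_trans laN; rewrite laE leeDl// adde_ge0.
  have := integral_close (mstep (G l)) (mf l) mN (ltW h0) (fun x => G01 l _) (f01 l)
    (fun x nN => GfN x nN l) nuT nuN (fair_coin_step (G0 l)) (fk l).
  rewrite mulr1 (_ : _ - k%:R^-1 = (\sum_s G l s - 2 ^+ m / k%:R) / 2 ^+ m).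
    by rewrite normrM normfV (gtr0_norm two0) ler_pdivrMr.
  by rewrite mulrBl mulrAC divff ?gt_eqF// mul1r.
have [||||||F bF FG] := @rebalance R 'I_k (m.-tuple bool) G (h + h).
- by rewrite card_ord.
- by rewrite card_tuple card_bool expn_gt0.
- exact: G0.
- exact: G1.
- by move=> l; rewrite card_ord card_tuple card_bool natrX; exact: Gsum.
- by rewrite card_ord.
rewrite card_ord in FG.
have F0 l s : 0 <= F l s by case: bF.
have F01 l s : 0 <= F l s <= 1 by rewrite F0 balanced_le1.
pose q := h + k%:R * (h + h).
have q0 : 0 <= q by rewrite addr_ge0 ?(ltW h0)// mulr_ge0//; lra.
have FfN x : ~ N x -> forall l, `|F l (string_of m x) - f l x| <= q.
  move=> nN l; rewrite [X in `|X|](_ : _ = (G l (string_of m x) - f l x) +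
    (F l (string_of m x) - G l (string_of m x))); last by ring.
  by apply: le_trans (ler_normD _ _) _; rewrite lerD//; exact: GfN.
exists m, F => // i j.
pose N2 : set (borel (cantor_space * cantor_space)%type) := fst @^-1` N `|` snd @^-1` N.
have mN2f : measurable
    ((fst : borel (cantor_space * cantor_space)%type -> borel cantor_space) @^-1` N).
  by rewrite -[X in measurable X]setTI; exact: measurable_borel_fst.
have mN2s : measurable
    ((snd : borel (cantor_space * cantor_space)%type -> borel cantor_space) @^-1` N).
  by rewrite -[X in measurable X]setTI; exact: measurable_borel_snd.
have mN2 : measurable N2 by exact: measurableU.
have muN2 : (mu N2 <= (h + h)%:E)%E.
  rewrite EFinD; apply: le_trans (measureU2 _ mN2f mN2s) _.
  apply: leeD; apply: le_trans laN; rewrite laE.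
    by rewrite addeCA leeDl// adde_ge0.
  by rewrite addeA leeDr// adde_ge0.
have prod01 (x y : R) : 0 <= x <= 1 -> 0 <= y <= 1 -> 0 <= x * y <= 1.
  by move=> /andP[x0 x1] /andP[y0 y1]; rewrite mulr_ge0// mulr_ile1.
have mprod (u v : borel cantor_space -> R) : measurable_fun setT u -> measurable_fun setT v ->
    measurable_fun setT (fun p : borel (cantor_space * cantor_space)%type => u p.1 * v p.2).
  move=> mu' mv'; apply: measurable_funM.
    exact: (measurableT_comp mu' measurable_borel_fst).
  exact: (measurableT_comp mv' measurable_borel_snd).
have q20 : 0 <= 2 * q by rewrite mulr_ge0.
have muM : (mu setT <= M%:E)%E by rewrite muT.
have FfN2 p : ~ N2 p ->
    `|F i (string_of m p.1) * F j (string_of m p.2) - f i p.1 * f j p.2| <= 2 * q.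
  move=> /not_orP[/(FfN p.1)/(_ i) n1 /(FfN p.2)/(_ j) n2].
  rewrite [X in `|X|](_ : _ = (F i (string_of m p.1) - f i p.1) * F j (string_of m p.2) +
    f i p.1 * (F j (string_of m p.2) - f j p.2)); last by ring.
  rewrite mulr_natl mulr2n; apply: le_trans (ler_normD _ _) _; rewrite !normrM.
  have /andP[F0' F1'] := F01 j (string_of m p.2); have /andP[f0' f1'] := f01 i p.1.
  rewrite (ger0_norm F0') (ger0_norm f0') lerD//.
    by rewrite -[leRHS]mulr1 ler_pM.
  by rewrite -[leRHS]mul1r ler_pM.
have := integral_close (mprod _ _ (mstep (F i)) (mstep (F j))) (mprod _ _ (mf i) (mf j)) mN2 q20
  (fun p => prod01 _ _ (F01 i _) (F01 j _)) (fun p => prod01 _ _ (f01 i _) (f01 j _)) FfN2 muM muN2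
  (square_step mu_box i j F0) (esym (zE i j)).
move=> /le_trans; apply; apply: le_trans hX.
by rewrite /q /X le_eqVlt; apply/orP; left; apply/eqP; ring.
Qed.

Lemma sum_1tuple (V : nmodType) (G : seq bool -> V) :
  \sum_(p : 1.-tuple bool) G p = \sum_b G [:: b].
Proof.
rewrite (reindex (fun b => [tuple b]))//; apply: onW_bij; apply: inj_card_bij.
  by move=> b c /(congr1 val)/= [].
by rewrite card_tuple card_bool.
Qed.

Theorem theorem4p2 (R : realType) (n : nat -> nat)
    (S : forall i : nat, 'M[R]_(n i))
    (n_gt0 : forall i, (0 < n i)%N)
    (S_ge0 : forall i a b, 0 <= S i a b)
    (S_sym : forall i, (S i)^T = S i)
    (S_cvg : convergent_matrices S) :
  exists mu : {finite_measure set (borel (cantor_space * cantor_space)%type) -> \bar R},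
    symmetric_measure mu /\
    forall k : nat, (0 < k)%N ->
      hausdorff_cvg (fun i => matrix_shape (S i) k) (measure_shape mu k).
Proof.
have [c [c0 Sc SY]] := S_cvg.
have S_le i : entry_sum (S i) <= c by rewrite ltW.
have S_hausdorff k : (0 < k)%N -> exists Y : set 'M[R]_k,
    hausdorff_cvg (fun i => matrix_shape (S i) k) Y.
  by move=> /SY[Y [_ _ ?]]; exists Y.
have [a [alim ablock aden]] := limit_tree n_gt0 S_ge0 S_le S_hausdorff.
have tuple_of s t : size s = size t -> exists m (u v : m.-tuple bool), s = u /\ t = v.
  by move=> st; exists (size s), (in_tuple s), (tcast (esym st) (in_tuple t)); rewrite val_tcast.
have a_ge0 s t : size s = size t -> 0 <= a s t.
  by move=> /tuple_of[m [u [v [-> ->]]]]; exact: (limit_shape_ge0 S_ge0 S_le u v (alim m)).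
have a_sym s t : size s = size t -> a s t = a t s.
  by move=> /tuple_of[m [u [v [-> ->]]]]; exact: (limit_shape_sym u v S_sym (alim m)).
have a_split s t : size s = size t -> a s t = \sum_b \sum_c a (rcons s b) (rcons t c).
  move=> st; rewrite (ablock 1%N _ _ st) /block_sum.
  rewrite (sum_1tuple (fun p => \sum_(q : 1.-tuple bool) a (s ++ p) (t ++ q))).
  apply: eq_bigr => b _; rewrite (sum_1tuple (fun q => a (s ++ [:: b]) (t ++ q))).
  by apply: eq_bigr => d _; rewrite !cats1.
have [mu [mu_sym mu_box]] := symmetric_square_measure a_ge0 a_split a_sym.
exists mu; split=> // k k0; have [Y [cY _ SYk]] := SY k k0.
suff -> : measure_shape mu k = Y by [].
apply/seteqP; split=> B.
  rewrite [X in _ -> X B]((closure_id Y).1 cY); apply: closure_subset => {}B [f fP Bf].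
  rewrite ((closure_id Y).1 cY); apply/closure_entrywise => e e0.
  have [m [F bF FB]] := step_approximation mu_box k0 e0 fP Bf.
  exists (\matrix_(i, j) coarsen (fun s t : m.-tuple bool => a s t) F i j).
    apply/(limit_shapeP _ k0 cY SYk).
    have := limit_shape_comp _ bF (alim m); rewrite card_tuple card_bool expn_gt0 => /(_ isT).
    by congr limit_shape; apply/funext => i; apply/funext => j; rewrite mxE.
  by move=> i j; rewrite mxE.
move=> /(limit_shapeP _ k0 cY SYk) Blim; apply/closure_entrywise => e e0.
have [m [F bF FB]] := aden k _ e k0 Blim e0.
exists (\matrix_(i, j) coarsen (fun s t : m.-tuple bool => a s t) F i j).
  exists (fun l x => F l (string_of m x)); first exact: fractional_step.
  by move=> i j; rewrite mxE (square_step mu_box)//; case: bF.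
by move=> i j; rewrite mxE.
Qed.
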